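(* Let $G$ be a second countable locally compact abelian group, let $\Lambda\subset G\times\widehat G$ be a lattice (a discrete cocompact subgroup), and let $n,d\in\mathbb N$. Let $E$ be the Heisenberg module of $\Lambda$. If there is $g\in M_{n,d}(E)$ such that $\mathcal G(g;\Lambda)$ is an $(n,d)$-matrix Gabor frame for $L^2(G)$, then $$s(\Lambda)\le\frac nd .$$
   Context: Haar measures on $G$ and $\widehat G$ are normalized so that the Plancherel theorem holds; $\Lambda$ carries counting measure, and $(G\times\widehat G)/\Lambda$ the Haar measure for which Weil's formula $\int_{G\times\widehat G}f=\int_{(G\times\widehat G)/\Lambda}\int_\Lambda f(\xi+\lambda)\,d\lambda\,d\dot\xi$ holds. The size of $\Lambda$ is $s(\Lambda)=\int_{(G\times\widehat G)/\Lambda}1$. For $\xi=(x,\omega)\in G\times\widehat G$, $\pi(\xi)f(t)=\omega(t)f(t-x)$ on $L^2(G)$. For an LCA group $H$, the Feichtinger algebra is $S_0(H)=\{f\in L^2(H): V_ff\in L^1(H\times\widehat H)\}$, $V_gf(\xi)=\langle f,\pi(\xi)g\rangle$. Let $A\subset\mathbb B(L^2(G))$ be the norm closure of $\{\int_\Lambda a(\lambda)\pi(\lambda)\,d\lambda: a\in S_0(\Lambda)\}$ (the twisted group $C^*$-algebra of $\Lambda$). The Heisenberg module $E$ is the completion of $S_0(G)$ in the norm $\|{}_\bullet\langle f,f\rangle\|^{1/2}$, where ${}_\bullet\langle f,g\rangle=\int_\Lambda\langle f,\pi(\lambda)g\rangle\pi(\lambda)\,d\lambda\in A$. The inclusion $S_0(G)\subset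 L^2(G)$ extends to a continuous injection $E\hookrightarrow L^2(G)$, by which $E$ is regarded as a subspace of $L^2(G)$ and $M_{n,d}(E)$ ($n\times d$ matrices over $E$, rows indexed by $\mathbb Z_n=\mathbb Z/n\mathbb Z$, columns by $\mathbb Z_d$) as a subspace of $L^2(G\times\mathbb Z_n\times\mathbb Z_d)$, writing $f_{i,j}=f(\cdot,i,j)$. For $g\in M_{n,d}(E)$ let $\mathcal G(g;\Lambda)=\{\pi(\lambda)g_{i,j}:\lambda\in\Lambda\}_{i\in\mathbb Z_n,j\in\mathbb Z_d}$ and let $C_g:L^2(G\times\mathbb Z_n\times\mathbb Z_d)\to L^2(\Lambda\times\mathbb Z_n\times\mathbb Z_n)$ be the (bounded) operator $(C_gf)_{k,l}(\lambda)=\sum_{m\in\mathbb Z_d}\langle f_{k,m},\pi(\lambda)g_{l,m}\rangle$. $\mathcal G(g;\Lambda)$ is an $(n,d)$-matrix Gabor frame for $L^2(G)$ if $S_g=C_g^*C_g$ is an isomorphism of $L^2(G\times\mathbb Z_n\times\mathbb Z_d)$. *)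

(* Defs.v *)
From HB Require Import structures.
From mathcomp Require Import all_boot all_order all_algebra.
From mathcomp Require Import ring_quotient complex.
From mathcomp Require Import all_classical all_reals all_analysis.
From mathcomp Require Import measurable_realfun.

Set Implicit Arguments.
Unset Strict Implicit.
Unset Printing Implicit Defensive.

Import Order.TTheory GRing.Theory Num.Theory.
Import numFieldNormedType.Exports.

Local Open Scope classical_set_scope.
Local Open Scope ring_scope.

(* An abelian group with a topology, carrying its Borel sigma-algebra; the
   alias is pointed by 0 because measurable types are pointed. *)
Definition borel (H : PreTopologicalZmodule.type) : Type := H.

Section borel_measurable.
Variable H : PreTopologicalZmodule.type.

HB.instance Definition _ := Choice.on (borel H).
HB.instance Definition _ := isPointed.Build (borel H) (0 : H).
HB.instance Definition _ := @isMeasurable.Build (sigma_display (@open H))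
  (borel H) <<s @open H >> (@sigma_algebra0 _ setT (@open H))
  (@sigma_algebraC (borel H) (@open H)) (@sigma_algebra_bigcup _ setT (@open H)).

End borel_measurable.

(* Every group below is second countable, locally compact and Hausdorff, so
   Borel measures that are finite on compact sets are regular and sigma-finite;
   regularity is not required here, and typing a Haar measure as a
   sigma_finite_measure further down is no restriction. *)
Definition is_haar (R : realType) (H : PreTopologicalZmodule.type)
    (mu : {measure set (borel H) -> \bar R}) : Prop :=
  [/\ forall (x : H) (A : set (borel H)), measurable A ->
        mu [set (x + y : H) | y in A] = mu A,
      forall K : set H, compact K -> (mu K < +oo)%E
    & forall U : set H, open U -> U !=set0 -> (0 < mu U)%E].

Section L2.
Context d (T : measurableType d) (R : realType).
Variable mu : {measure set T -> \bar R}.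
Local Notation C := R[i].

Definition cmeasurable (f : T -> C) : Prop :=
  measurable_fun setT (fun x => complex.Re (f x)) /\
  measurable_fun setT (fun x => complex.Im (f x)).

Definition cnorm (p : R) (f : T -> C) : \bar R :=
  ('N[mu]_(p%:E)[(fun x => (Normc.normc (f x))%:E)])%E.

Definition L1 (f : T -> C) : Prop := cmeasurable f /\ (cnorm 1 f < +oo)%E.
Definition L2 (f : T -> C) : Prop := cmeasurable f /\ (cnorm 2 f < +oo)%E.

Definition cintegral (f : T -> C) : C :=
  (Rintegral mu setT (fun x => complex.Re (f x)) +i*
   Rintegral mu setT (fun x => complex.Im (f x)))%C.

Definition ip (f g : T -> C) : C := cintegral (fun x => f x * (g x)^*%C).

(* The space L^2(T x Z_m x Z_n) as m x n matrices over L^2(T). *)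
Definition L2mx m n (F : 'M[T -> C]_(m, n)) : Prop := forall i j, L2 (F i j).

Definition ipmx m n (F K : 'M[T -> C]_(m, n)) : C :=
  \sum_i \sum_j ip (F i j) (K i j).

Definition cnormmx m n (F : 'M[T -> C]_(m, n)) : \bar R :=
  ((\sum_i \sum_j cnorm 2 (F i j) `^ 2) `^ 2^-1)%E.

(* Elements of L^2 are represented by functions, so an operator on L^2 is given
   by its graph, a relation between functions. *)
Definition opnorm (A : (T -> C) -> (T -> C) -> Prop) : \bar R :=
  ereal_sup [set y | exists h u,
    [/\ L2 h, (cnorm 2 h <= 1)%E, A h u & y = cnorm 2 u]].

Definition L2mx_isomorphism m n
    (A : 'M[T -> C]_(m, n) -> 'M[T -> C]_(m, n) -> Prop) : Prop :=
  [/\ forall f, L2mx f -> exists2 u, L2mx u & A f u,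
      forall u, L2mx u -> exists2 f, L2mx f & A f u,
      forall f f' u, L2mx f -> L2mx f' -> A f u -> A f' u ->
        forall i j, f i j = f' i j %[ae mu]
    & exists2 M : R, 0 < M & forall f u, L2mx f -> A f u ->
        (cnormmx u <= M%:E * cnormmx f)%E /\
        (cnormmx f <= M%:E * cnormmx u)%E].

End L2.

Section dual_group.
Variables (R : realType) (G : topologicalZmodType).
Local Notation C := R[i].

Definition is_character (chi : G -> C) : Prop :=
  [/\ continuous (chi : G -> C^o), forall x, `|chi x| = 1
    & forall x y, chi (x + y) = chi x * chi y].

Record dual := Dual { dual_fun :> G -> C; _ : `[< is_character dual_fun >] }.

HB.instance Definition _ := [isSub for dual_fun].
HB.instance Definition _ := gen_eqMixin dual.
HB.instance Definition _ := gen_choiceMixin dual.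

Lemma dualP (w : dual) : is_character w.
Proof. by case: w => f /= /asboolP. Qed.

Lemma dual_inj (v w : dual) : (forall x, v x = w x) -> v = w.
Proof. by move=> vw; apply/val_inj/funext. Qed.

Lemma dual0_subproof : `[< is_character (fun=> 1) >].
Proof.
apply/asboolP; split=> [|x|x y]; [exact: cst_continuous| |];
by rewrite ?normr1 ?mulr1.
Qed.

Lemma dualN_subproof (w : dual) : `[< is_character (fun x => w (- x)) >].
Proof.
have [cw w1 wD] := dualP w; apply/asboolP; split=> [x|x|x y].
- apply: (@continuous_comp _ _ _ (-%R : G -> G) (w : G -> C^o)); first exact: opp_continuous.
  exact: cw.
- exact: w1.
- by rewrite opprD wD.
Qed.

Lemma dualD_subproof (v w : dual) : `[< is_character (fun x => v x * w x) >].
Proof.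
have [cv v1 vD] := dualP v; have [cw w1 wD] := dualP w.
apply/asboolP; split=> [x|x|x y].
- by apply: cvgM; [exact: cv|exact: cw].
- by rewrite normrM v1 w1 mulr1.
- by rewrite vD wD mulrACA.
Qed.

Definition dual_zero : dual := Dual dual0_subproof.
Definition dual_opp (w : dual) : dual := Dual (dualN_subproof w).
Definition dual_add (v w : dual) : dual := Dual (dualD_subproof v w).

Lemma dual_addA : associative dual_add.
Proof. by move=> u v w; apply: dual_inj => x /=; rewrite mulrA. Qed.

Lemma dual_addC : commutative dual_add.
Proof. by move=> v w; apply: dual_inj => x /=; rewrite mulrC. Qed.

Lemma dual_add0 : left_id dual_zero dual_add.
Proof. by move=> w; apply: dual_inj => x /=; rewrite mul1r. Qed.

Lemma dual_addN : left_inverse dual_zero dual_opp dual_add.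
Proof.
move=> w; apply: dual_inj => x /=; have [_ w1 wD] := dualP w.
have w0 : w 0 = 1.
  have w0n0 : w 0 != 0 by rewrite -normr_eq0 w1 oner_eq0.
  by apply: (mulfI w0n0); rewrite mulr1 -wD addr0.
by rewrite -wD addNr.
Qed.

(* The group law of the dual group is pointwise multiplication, written
   additively. *)
HB.instance Definition _ :=
  GRing.isZmodule.Build dual dual_addA dual_addC dual_add0 dual_addN.

HB.instance Definition _ := Topological.copy dual
  (initial_topology (dual_fun : dual -> {compact-open, G -> C^o})).

Definition phase_space : Type := (G * dual)%type.
HB.instance Definition _ := Topological.on phase_space.
HB.instance Definition _ := GRing.Zmodule.on phase_space.

End dual_group.

Section lattice.
Variables (P : PreTopologicalZmodule.type) (L : zmodClosed P).

Definition lattice_quot : Type := quotient_topology (Quotient.quot L).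
HB.instance Definition _ := Topological.on lattice_quot.
HB.instance Definition _ := Quotient.on lattice_quot.
HB.instance Definition _ := GRing.isZmodule.Build lattice_quot
  (@Quotient.addqA P L) (@Quotient.addqC P L)
  (@Quotient.add0q P L) (@Quotient.addNq P L).

(* The sigma-algebra of all subsets of L, on which counting measure lives. *)
Definition lattice_elt : Type := {x : P | x \in L}.
HB.instance Definition _ := Choice.on lattice_elt.
HB.instance Definition _ :=
  isPointed.Build lattice_elt (exist _ 0 (rpred0 L)).
Definition lattice_mtype : Type :=
  g_sigma_algebraType [set: set lattice_elt].
HB.instance Definition _ := Measurable.on lattice_mtype.

Definition is_lattice : Prop :=
  (forall l : P, l \in L -> \forall x \near l, x \in L -> x = l) /\
  compact [set: lattice_quot].

End lattice.

Section gabor.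
Variables (R : realType) (G : topologicalZmodType).
Local Notation C := R[i].
Local Notation phase := (phase_space R G).

Definition tfshift (xi : phase) (f : G -> C) : G -> C :=
  fun t => xi.2 t * f (t - xi.1).

Variables (mu : {sigma_finite_measure set (borel G) -> \bar R}).
Variables (nu : {sigma_finite_measure set (borel (dual R G)) -> \bar R}).

Definition fourier (f : G -> C) (w : dual R G) : C :=
  cintegral mu (fun t : borel G => f t * (w t)^*%C).

Definition plancherel : Prop := forall f : G -> C,
  L1 mu f -> L2 mu f -> cnorm nu 2 (fourier f) = cnorm mu 2 f.

Definition stft (g f : G -> C) (xi : phase) : C := ip mu f (tfshift xi g).

Definition S0 (f : G -> C) : Prop := L2 mu f /\ L1 (mu \x nu)%E (stft f f).

Variable L : zmodClosed phase.
Local Notation cnt := (@counting (lattice_mtype L) R).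

(* The inner integral is invariant under translating the argument of f by L, so
   it does not depend on the representative of q. *)
Definition weil (rho : {measure set (borel (lattice_quot L)) -> \bar R}) :
    Prop :=
  forall f : borel G * borel (dual R G) -> \bar R,
    measurable_fun setT f -> (forall xi, 0 <= f xi)%E ->
    (\int[(mu \x nu)%E]_xi f xi =
     \int[rho]_q \int[cnt]_l f ((repr (q : lattice_quot L) + val l)%R : phase))%E.

Definition lattice_size
    (rho : {measure set (borel (lattice_quot L)) -> \bar R}) : \bar R :=
  (\int[rho]_q 1)%E.

(* The graph of the operator given by the weak integral over L of
   a(l) pi(l) dl. *)
Definition integrated (a : lattice_mtype L -> C) (h u : G -> C) : Prop :=
  L2 mu u /\ forall k : G -> C, L2 mu k ->
    ip mu u k = cintegral cnt (fun l => a l * ip mu (tfshift (val l) h) k).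

Definition heis_coeff (f g : G -> C) (l : lattice_mtype L) : C :=
  ip mu f (tfshift (val l) g).

Definition heis_norm (f : G -> C) : \bar R :=
  (opnorm mu (integrated (heis_coeff f f)) `^ 2^-1)%E.

(* The image in L^2(G) of the completion of S_0(G) for heis_norm: the L^2-limits
   of the heis_norm-Cauchy sequences in S_0(G). *)
Definition heisenberg_module (f : G -> C) : Prop :=
  L2 mu f /\ exists u : nat -> G -> C,
    [/\ forall k, S0 (u k),
        forall e : R, 0 < e -> exists N, forall k m, (N <= k)%N -> (N <= m)%N ->
          (heis_norm (u k \- u m)%R < e%:E)%E
      & (fun k => cnorm mu 2 (u k \- f)) @ \oo --> 0%E].

Section matrix_gabor.
Variables (n d : nat) (g : 'M[G -> C]_(n, d)).

Definition coefficient (f : 'M[G -> C]_(n, d)) :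
    'M[lattice_mtype L -> C]_(n, n) :=
  \matrix_(k, l) fun x => \sum_(m < d) ip mu (f k m) (tfshift (val x) (g l m)).

(* The graph of the Hilbert space adjoint of [coefficient]. *)
Definition coefficient_adjoint (c : 'M[lattice_mtype L -> C]_(n, n))
    (v : 'M[G -> C]_(n, d)) : Prop :=
  L2mx mu v /\ forall h : 'M[G -> C]_(n, d), L2mx mu h ->
    ipmx mu v h = ipmx cnt c (coefficient h).

Definition frame_operator (f v : 'M[G -> C]_(n, d)) : Prop :=
  coefficient_adjoint (coefficient f) v.

Definition matrix_gabor_frame : Prop := L2mx_isomorphism mu frame_operator.

End matrix_gabor.
End gabor.

(* Main.v *)
Require Import Defs.
From HB Require Import structures.
From mathcomp Require Import all_boot all_order all_algebra.
From mathcomp Require Import ring_quotient complex.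
From mathcomp Require Import all_classical all_reals all_analysis.
From mathcomp Require Import measurable_realfun.
From mathcomp Require finmap.
From mathcomp Require Import ring lra.

Set Implicit Arguments.
Unset Strict Implicit.
Unset Printing Implicit Defensive.

Import Order.TTheory GRing.Theory Num.Theory.
Import numFieldNormedType.Exports.

Local Open Scope classical_set_scope.
Local Open Scope ring_scope.

(** The inequality is the density theorem for Gabor frames, obtained by computing
    a trace in two ways.

    Write the condition one row at a time. With g_l the l-th row of g, an element
    of L^2(G)^d, and C_l phi (lambda) = <phi, pi(lambda) g_l>, the frame operator
    of g acts on each row separately, by <S phi, psi> = sum_l <C_l phi, C_l psi>.
    It is onto ([frame_rel_onto]), so there are dual windows gamma_l with
    S gamma_l = g_l. On the one hand z = <g_l, gamma_l> satisfies
    Re z = sum_i |C_i gamma_l|^2 >= |C_l gamma_l (0)|^2 = |z|^2, whence Re z <= 1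
    ([Re_dual_window_le1]), so that sum_l Re <g_l, gamma_l> <= n.

    On the other hand S commutes with the shifts pi(lambda)
    ([frame_rel_shift]), which gives the reconstruction formula
    |f|^2 = sum_l sum_lambda <f, pi(lambda) gamma_l> <pi(lambda) g_l, f>. Take
    for f the vector with the single nonzero entry pi(xi) h in column m and
    integrate over xi in (G x G^)/Lambda: the left side gives s(Lambda) |h|^2,
    and the right side unfolds by Weil's formula to an integral over G x G^, equal
    to sum_l <g_lm, gamma_lm> |h|^2 by the orthogonality relations of the
    short-time Fourier transform ([moyal]). Summing over the d columns gives
    d s(Lambda) <= sum_l Re <g_l, gamma_l> <= n.

    Three points of the argument need care.

    Weil's formula concerns nonnegative functions, so the reconstruction formula is
    polarized first ([frame_polarization]): it compares the coefficients of
    g_l + gamma_l with those of g_l - gamma_l. The integrals over the quotient are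
    then lower integrals of functions built on representatives, and one only uses
    that the lower integral is superadditive ([integral_addr_ge]).

    Sums over the lattice that do not converge have an arbitrary value, so it is
    not obvious that the equation <S phi, phi> = sum_l |C_l phi|^2 bounds
    anything. It does: the left side is a quadratic form, and the parallelogram
    law forces a window with some divergent coefficient sum to contribute nothing
    at all ([unsummable_vanish]). The remaining windows, at most n of them, still
    satisfy every relation above ([frame_rel_good]).

    The window h is the indicator function of a symmetric relatively compact open
    set K. Since h is bounded, f times a translate of h lies in L^1 and L^2
    whenever f is in L^2, so that Plancherel's formula applies to it directly;
    since K is symmetric, the integral of h(t - x) over x is mu(K) by translation
    invariance alone. *)

(** * Complex numbers *)

Section complex_numbers.
Variable R : realType.
Local Notation C := R[i].
Implicit Types z w : C.

Definition sqn z : R := complex.Re z ^+ 2 + complex.Im z ^+ 2.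

Lemma sqn_ge0 z : 0 <= sqn z.
Proof. by rewrite addr_ge0 ?sqr_ge0. Qed.

Lemma sqr_normc_sqn z : Normc.normc z ^+ 2 = sqn z.
Proof. by case: z => a b; rewrite /sqn /= sqr_sqrtr ?addr_ge0 ?sqr_ge0. Qed.

Lemma sqnM z w : sqn (z * w) = sqn z * sqn w.
Proof. by case: z w => [a b] [u v]; rewrite /sqn /=; ring. Qed.

Lemma sqnJ z : sqn z^*%C = sqn z.
Proof. by case: z => [a b]; rewrite /sqn /= sqrrN. Qed.

Lemma sqn_par z w : sqn (z + w) + sqn (z - w) = 2 * (sqn z + sqn w).
Proof. by case: z w => [a b] [u v]; rewrite /sqn /=; ring. Qed.

Lemma cReD z w : complex.Re (z + w) = complex.Re z + complex.Re w.
Proof. by case: z w => [a b] [u v]. Qed.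

Lemma cImD z w : complex.Im (z + w) = complex.Im z + complex.Im w.
Proof. by case: z w => [a b] [u v]. Qed.

Lemma cReM z w : complex.Re (z * w) =
  complex.Re z * complex.Re w - complex.Im z * complex.Im w.
Proof. by case: z w => [a b] [u v]. Qed.

Lemma cImM z w : complex.Im (z * w) =
  complex.Re z * complex.Im w + complex.Im z * complex.Re w.
Proof. by case: z w => [a b] [u v]. Qed.

Lemma cReJ z : complex.Re z^*%C = complex.Re z.
Proof. by case: z. Qed.

Lemma cImJ z : complex.Im z^*%C = - complex.Im z.
Proof. by case: z. Qed.

Lemma sqn_eq1 z : `|z| = 1 -> sqn z = 1.
Proof.
case: z => a b; rewrite normc_def => -[/= /(congr1 (fun x => x ^+ 2))].
by rewrite sqr_sqrtr ?addr_ge0 ?sqr_ge0// expr1n.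
Qed.

Lemma sqn_conj z : z * z^*%C = (sqn z)%:C%C.
Proof.
by case: z => a b; apply/eqP; rewrite eq_complex /sqn /=; apply/andP; split;
  apply/eqP; ring.
Qed.

Lemma conjD z w : (z + w)^*%C = z^*%C + w^*%C.
Proof. exact: rmorphD. Qed.

Lemma conjM z w : (z * w)^*%C = z^*%C * w^*%C.
Proof. exact: rmorphM. Qed.

Lemma conjN1 : (- 1 : C)^*%C = - 1.
Proof. by apply/eqP; rewrite eq_complex /= !oppr0 !eqxx. Qed.

Lemma Re_sum (I : finType) (Q : pred I) (F : I -> C) :
  complex.Re (\sum_(i | Q i) F i) = \sum_(i | Q i) complex.Re (F i).
Proof. by apply: (big_morph (@complex.Re R)) => // x y; exact: cReD. Qed.

End complex_numbers.

(** * Square-integrable complex functions *)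

Section L2_theory.
Context d (T : measurableType d) (R : realType).
Variable mu : {measure set T -> \bar R}.
Local Notation C := R[i].
Implicit Types (f g h : T -> C) (c z w : C).

Definition energy f : \bar R := (\int[mu]_x (sqn (f x))%:E)%E.

Lemma energy_ge0 f : (0 <= energy f)%E.
Proof. by apply: integral_ge0 => x _; rewrite lee_fin sqn_ge0. Qed.

Lemma cnorm2E f : cnorm mu 2 f = (energy f `^ 2^-1)%E.
Proof.
rewrite /cnorm unlock /energy; congr (_ `^ _)%E.
apply: eq_integral => x _; rewrite gee0_abs ?lee_fin ?sqrtr_ge0//; last first.
  by case: (f x) => a b; rewrite /= sqrtr_ge0.
rewrite poweR_EFin -sqr_normc_sqn powR_mulrn//.
by case: (f x) => a b; rewrite /= sqrtr_ge0.
Qed.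

Lemma L2E f : L2 mu f <-> cmeasurable f /\ (energy f < +oo)%E.
Proof.
rewrite /L2 cnorm2E; split=> -[mf ef]; split=> //.
  apply: (@lty_poweRy _ _ 2^-1); by [rewrite invr_neq0|].
by rewrite poweR_lty.
Qed.

Lemma cmeasurable_cst c : cmeasurable (fun _ : T => c).
Proof. by split; exact: measurable_cst. Qed.

Lemma cmeasurableD f g : cmeasurable f -> cmeasurable g ->
  cmeasurable (fun x => f x + g x).
Proof.
move=> [f1 f2] [g1 g2]; split.
- rewrite (_ : (fun _ => _) = (fun x => complex.Re (f x) + complex.Re (g x))).
    exact: measurable_funD.
  by apply/funext => x; case: (f x) (g x) => [a b] [u v].
- rewrite (_ : (fun _ => _) = (fun x => complex.Im (f x) + complex.Im (g x))).
    exact: measurable_funD.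
  by apply/funext => x; case: (f x) (g x) => [a b] [u v].
Qed.

Lemma cmeasurableM f g : cmeasurable f -> cmeasurable g ->
  cmeasurable (fun x => f x * g x).
Proof.
move=> [f1 f2] [g1 g2]; split.
- rewrite (_ : (fun _ => _) = (fun x => complex.Re (f x) * complex.Re (g x) -
     complex.Im (f x) * complex.Im (g x))).
    by apply: measurable_funB; exact: measurable_funM.
  by apply/funext => x; case: (f x) (g x) => [a b] [u v].
- rewrite (_ : (fun _ => _) = (fun x => complex.Re (f x) * complex.Im (g x) +
     complex.Im (f x) * complex.Re (g x))).
    by apply: measurable_funD; exact: measurable_funM.
  by apply/funext => x; case: (f x) (g x) => [a b] [u v].
Qed.

Lemma cmeasurableJ f : cmeasurable f -> cmeasurable (fun x => (f x)^*%C).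
Proof.
move=> [f1 f2]; split.
- by rewrite (_ : (fun _ => _) = (fun x => complex.Re (f x)))//;
    apply/funext => x; case: (f x).
- rewrite (_ : (fun _ => _) = (fun x => - complex.Im (f x))).
    exact: measurableT_comp.
  by apply/funext => x; case: (f x).
Qed.

Lemma measurable_sqnR f : cmeasurable f ->
  measurable_fun setT (fun x => sqn (f x)).
Proof. by move=> [f1 f2]; apply: measurable_funD; exact: measurable_funX. Qed.

Lemma measurable_sqn f : cmeasurable f ->
  measurable_fun setT (fun x => (sqn (f x))%:E).
Proof. by move=> mf; apply/measurable_EFinP; exact: measurable_sqnR. Qed.

Definition cintegrable f :=
  mu.-integrable setT (fun x => (complex.Re (f x))%:E) /\
  mu.-integrable setT (fun x => (complex.Im (f x))%:E).

Lemma cintegralD f g : cintegrable f -> cintegrable g ->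
  cintegral mu (fun x => f x + g x) = cintegral mu f + cintegral mu g.
Proof.
move=> [f1 f2] [g1 g2]; rewrite /cintegral; apply/eqP; rewrite eq_complex/=.
apply/andP; split; apply/eqP.
  by rewrite -RintegralD//; apply: eq_Rintegral => x _; rewrite cReD.
by rewrite -RintegralD//; apply: eq_Rintegral => x _; rewrite cImD.
Qed.

Lemma cintegralZ c f : cintegrable f ->
  cintegral mu (fun x => c * f x) = c * cintegral mu f.
Proof.
move=> [f1 f2]; rewrite /cintegral; apply/eqP; rewrite eq_complex/= cReM cImM/=.
apply/andP; split; apply/eqP.
  rewrite -!RintegralZl// -RintegralB//; last 2 first.
  - exact: (integrableZl measurableT (complex.Re c) f1).
  - exact: (integrableZl measurableT (complex.Im c) f2).
  by apply: eq_Rintegral => x _; rewrite cReM.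
rewrite -!RintegralZl// -RintegralD//; last 2 first.
- exact: (integrableZl measurableT (complex.Re c) f2).
- exact: (integrableZl measurableT (complex.Im c) f1).
by apply: eq_Rintegral => x _; rewrite cImM.
Qed.

(** The products and sums of square-integrable functions met below are all
    majorized in this form, by inequalities such as 2|ab| <= |a|^2 + |b|^2. *)
Lemma integrable_le_sqn (u : T -> R) f g : measurable_fun setT u ->
  (forall x, `|u x| <= sqn (f x) + sqn (g x)) -> L2 mu f -> L2 mu g ->
  mu.-integrable setT (fun x => (u x)%:E).
Proof.
move=> mu_ ule /L2E[mf ef] /L2E[mg eg]; apply/integrableP; split.
  exact/measurable_EFinP.
apply: (@le_lt_trans _ _ (\int[mu]_x ((sqn (f x))%:E + (sqn (g x))%:E))%E).
  apply: ge0_le_integral => //.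
  - by apply: measurableT_comp => //; exact/measurable_EFinP.
  - by apply: emeasurable_funD; exact: measurable_sqn.
  - by move=> x _; rewrite -EFinD/= lee_fin.
rewrite ge0_integralD//; first exact: lte_add_pinfty.
all: by [move=> x _; rewrite lee_fin sqn_ge0|exact: measurable_sqn].
Qed.

Lemma L2_cintegrable f g : L2 mu f -> L2 mu g ->
  cintegrable (fun x => f x * (g x)^*%C).
Proof.
move=> Lf Lg; have [mf _] := Lf; have [mg _] := Lg.
have [m1 m2] := cmeasurableM mf (cmeasurableJ mg).
split; apply: (@integrable_le_sqn _ f g) => // x;
  rewrite ?cReM ?cImM cReJ cImJ /sqn; move: (complex.Re _) (complex.Im _)
  (complex.Re _) (complex.Im _) => a b c e; rewrite ler_norml; apply/andP;
  split; have := sqr_ge0 (a + c); have := sqr_ge0 (a - c);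
  have := sqr_ge0 (a + e); have := sqr_ge0 (a - e); have := sqr_ge0 (b + c);
  have := sqr_ge0 (b - c); have := sqr_ge0 (b + e); have := sqr_ge0 (b - e);
  rewrite !sqrrD ?sqrrN; nra.
Qed.

Lemma L2Z c f : L2 mu f -> L2 mu (fun x => c * f x).
Proof.
move=> /L2E[mf ef]; apply/L2E; split.
  by apply: cmeasurableM => //; exact: cmeasurable_cst.
rewrite /energy; under eq_integral do rewrite sqnM EFinM.
rewrite ge0_integralZl_EFin//.
- by rewrite lte_mul_pinfty ?lee_fin ?sqn_ge0.
- by move=> x _; rewrite lee_fin sqn_ge0.
- exact: measurable_sqn.
- exact: sqn_ge0.
Qed.

Lemma L2D f g : L2 mu f -> L2 mu g -> L2 mu (fun x => f x + g x).
Proof.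
move=> Lf Lg; have [mf _] := Lf; have [mg _] := Lg.
apply/L2E; split; first exact: cmeasurableD.
have m := cmeasurableD mf mg.
have /integrableP[_] : mu.-integrable setT (fun x => (sqn (f x + g x))%:E).
  apply: (@integrable_le_sqn _ (fun x => 2 * f x) (fun x => 2 * g x)).
  - exact/measurable_EFinP/measurable_sqn.
  - move=> x; rewrite ger0_norm ?sqn_ge0// !sqnM.
    have -> : sqn (2 : C) = 4 :> R by rewrite /sqn/=; ring.
    have := sqn_par (f x) (g x); have := sqn_ge0 (f x - g x).
    have := sqn_ge0 (f x); have := sqn_ge0 (g x); lra.
  - exact: L2Z.
  - exact: L2Z.
rewrite /energy; under eq_integral do rewrite gee0_abs ?lee_fin ?sqn_ge0//.
by [].
Qed.

Lemma L2B f g : L2 mu f -> L2 mu g -> L2 mu (fun x => f x - g x).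
Proof.
move=> Lf Lg; have := L2D Lf (L2Z (-1) Lg).
by under eq_fun do rewrite mulN1r.
Qed.

Lemma L20 : L2 mu (fun _ => 0).
Proof.
apply/L2E; split; first exact: cmeasurable_cst.
rewrite /energy (eq_integral (cst 0%E)) ?integral0 ?ltry// => x _.
by rewrite /sqn/= expr0n/= addr0.
Qed.

Lemma ipDl f g h : L2 mu f -> L2 mu g -> L2 mu h ->
  ip mu (fun x => f x + g x) h = ip mu f h + ip mu g h.
Proof.
move=> Lf Lg Lh; rewrite /ip -cintegralD; [|exact: L2_cintegrable..].
by congr cintegral; apply/funext => x; rewrite mulrDl.
Qed.

Lemma ipZl c f h : L2 mu f -> L2 mu h ->
  ip mu (fun x => c * f x) h = c * ip mu f h.
Proof.
move=> Lf Lh; rewrite /ip -cintegralZ; last exact: L2_cintegrable.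
by congr cintegral; apply/funext => x; rewrite mulrA.
Qed.

(** The integrands agree pointwise, so this holds even when the integral is
    undefined; the symmetry of the frame form before its convergence is known
    rests on it. *)
Lemma Re_ipC f g : complex.Re (ip mu f g) = complex.Re (ip mu g f).
Proof.
by rewrite /ip /=; apply: eq_Rintegral => x _; rewrite !cReM !cReJ !cImJ; ring.
Qed.

Lemma ipC f g : L2 mu f -> L2 mu g -> ip mu f g = (ip mu g f)^*%C.
Proof.
move=> Lf Lg; apply/eqP; rewrite eq_complex; apply/andP; split; apply/eqP.
  by rewrite cReJ Re_ipC.
rewrite cImJ /= -mulN1r -RintegralZl//; last exact: (L2_cintegrable _ _).2.
by apply: eq_Rintegral => x _; rewrite !cImM !cReJ !cImJ; ring.
Qed.

Lemma ipDr f g h : L2 mu f -> L2 mu g -> L2 mu h ->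
  ip mu h (fun x => f x + g x) = ip mu h f + ip mu h g.
Proof.
move=> Lf Lg Lh; rewrite ipC// ?ipDl//; last exact: L2D.
by rewrite rmorphD (ipC Lh Lf) (ipC Lh Lg).
Qed.

Lemma ipZr c f h : L2 mu f -> L2 mu h ->
  ip mu h (fun x => c * f x) = c^*%C * ip mu h f.
Proof.
move=> Lf Lh; rewrite ipC// ?ipZl//; last exact: L2Z.
by rewrite rmorphM (ipC Lh Lf).
Qed.

Lemma Re_ip_energy f : complex.Re (ip mu f f) = fine (energy f).
Proof.
rewrite /ip /=; congr fine; apply: eq_integral => x _; congr EFin.
by rewrite cReM cReJ cImJ /sqn; ring.
Qed.

Lemma energy_fin f : L2 mu f -> (fine (energy f))%:E = energy f.
Proof. by move=> /L2E[_ ef]; rewrite fineK// ge0_fin_numE ?energy_ge0. Qed.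

Lemma cintegral0 : cintegral mu (fun _ : T => 0 : C) = 0.
Proof.
rewrite /cintegral; apply/eqP; rewrite eq_complex /=.
by rewrite Rintegral_cst// mul0r eqxx.
Qed.

Lemma fine_energyD f g : L2 mu f -> L2 mu g ->
  fine (energy (fun x => f x + g x)) =
  fine (energy f) + 2 * complex.Re (ip mu f g) + fine (energy g).
Proof.
move=> Lf Lg; rewrite -!Re_ip_energy ipDl//; last exact: L2D.
by rewrite !ipDr// !cReD (Re_ipC g f); ring.
Qed.

Lemma fine_energyB f g : L2 mu f -> L2 mu g ->
  fine (energy (fun x => f x - g x)) =
  fine (energy f) - 2 * complex.Re (ip mu f g) + fine (energy g).
Proof.
move=> Lf Lg; have Ng : L2 mu (fun x => -1 * g x) by exact: L2Z.
under eq_fun do rewrite -mulN1r.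
rewrite fine_energyD// ipZr// cReM cReJ cImJ /= oppr0 !mulN1r.
rewrite (_ : energy (fun x => -1 * g x) = energy g); first by ring.
by apply: eq_integral => x _; rewrite sqnM /sqn /=; congr EFin; ring.
Qed.

Lemma fine_energy_par f g : L2 mu f -> L2 mu g ->
  fine (energy (fun x => f x + g x)) + fine (energy (fun x => f x - g x)) =
  2 * (fine (energy f) + fine (energy g)).
Proof. by move=> Lf Lg; rewrite fine_energyD// fine_energyB//; ring. Qed.

(** Written without subtraction, so that it can be integrated with nonnegative
    functions only. *)
Lemma energy_polarization f g : L2 mu f -> L2 mu g ->
  energy (fun x => f x + g x) =
  (energy (fun x => f x - g x)%R + (4 * complex.Re (ip mu f g))%:E)%E.
Proof.
move=> Lf Lg; rewrite -(energy_fin (L2D Lf Lg)) -(energy_fin (L2B Lf Lg)).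
rewrite (fine_energyD Lf Lg) (fine_energyB Lf Lg) -EFinD; congr EFin; ring.
Qed.

Lemma ip0l h : ip mu (fun _ => 0) h = 0.
Proof. by rewrite /ip; under eq_fun do rewrite mul0r; exact: cintegral0. Qed.

Lemma ip0r h : ip mu h (fun _ => 0) = 0.
Proof.
by rewrite /ip; under eq_fun do rewrite conjc0 mulr0; exact: cintegral0.
Qed.

End L2_theory.

(** * Measure-preserving maps and lower integrals *)

Lemma cmeasurable_comp d1 d2 (T1 : measurableType d1) (T2 : measurableType d2)
    (R : realType) (f : T2 -> R[i]) (phi : T1 -> T2) :
  cmeasurable f -> measurable_fun setT phi -> cmeasurable (fun x => f (phi x)).
Proof.
move=> [f1 f2] mphi.
by split; [exact: (measurableT_comp f1 mphi)|exact: (measurableT_comp f2 mphi)].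
Qed.

Section preserving.
Context d (T : measurableType d) (R : realType).
Variable mu : {measure set T -> \bar R}.
Local Notation C := R[i].
Implicit Types (f g : T -> C).

Variables (phi : T -> T) (mphi : measurable_fun setT phi).
Hypothesis phiE : forall A, measurable A -> mu (phi @^-1` A) = mu A.

Lemma ge0_integral_comp (f : T -> \bar R) : measurable_fun setT f ->
  (forall x, 0 <= f x)%E -> (\int[mu]_x f (phi x) = \int[mu]_x f x)%E.
Proof.
move=> mf f0; transitivity (\int[pushforward mu phi]_(y in setT) f y)%E.
  by rewrite ge0_integral_pushforward.
by apply: eq_measure_integral => A mA _; exact: phiE.
Qed.

(** Both sides are defined from the positive and negative parts, which reduces
    the claim to nonnegative functions, divergent integrals included. *)
Lemma integral_comp (f : T -> \bar R) : measurable_fun setT f ->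
  (\int[mu]_x f (phi x) = \int[mu]_x f x)%E.
Proof.
move=> mf; rewrite integralE [RHS]integralE.
congr (_ - _)%E.
- rewrite -[RHS]ge0_integral_comp//; last exact: measurable_funepos.
  by apply: eq_integral => x _; rewrite !funeposE.
- rewrite -[RHS]ge0_integral_comp//; last exact: measurable_funeneg.
  by apply: eq_integral => x _; rewrite !funenegE.
Qed.

Lemma cintegral_comp f : cmeasurable f ->
  cintegral mu (fun x => f (phi x)) = cintegral mu f.
Proof.
move=> [f1 f2]; rewrite /cintegral /Rintegral.
rewrite (@integral_comp (fun x => (complex.Re (f x))%:E));
  last exact/measurable_EFinP.
by rewrite (@integral_comp (fun x => (complex.Im (f x))%:E));
  last exact/measurable_EFinP.
Qed.

Lemma energy_comp f : cmeasurable f ->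
  energy mu (fun x => f (phi x)) = energy mu f.
Proof.
move=> mf; apply: (@ge0_integral_comp (fun x => (sqn (f x))%:E)).
  exact: measurable_sqn.
by move=> x; rewrite lee_fin sqn_ge0.
Qed.

Lemma L2_comp f : L2 mu f -> L2 mu (fun x => f (phi x)).
Proof.
move=> /L2E[mf ef]; apply/L2E; split; first exact: cmeasurable_comp mphi.
by rewrite energy_comp.
Qed.

End preserving.

Section superadditivity.
Context d (T : measurableType d) (R : realType).
Variable m : {measure set T -> \bar R}.
Import HBNNSimple.

(** For a nonmeasurable f the integral is the lower one: adding c to a
    simple function below f gives one below f + c. *)
Lemma integral_addr_ge (f : T -> \bar R) (c : R) : (forall x, 0 <= f x)%E ->
  0 <= c -> (m setT < +oo)%E ->
  (\int[m]_x f x + c%:E * m setT <= \int[m]_x (f x + c%:E))%E.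
Proof.
move=> f0 c0 mfin; pose k := cst_nnsfun T (NngNum c0).
have kE : sintegral m k = (c%:E * m setT)%E.
  by rewrite -integralT_nnsfun -integral_cst//; apply: eq_integral.
have kfin : (c%:E * m setT)%E \is a fin_num.
  by rewrite fin_numM// ge0_fin_numE.
rewrite -leeBrDr// ge0_integralTE//; apply: ge_ereal_sup => _ [h hf <-].
rewrite leeBrDr// ge0_integralTE; last by move=> x; rewrite adde_ge0.
apply: ereal_sup_ubound; exists (add_nnsfun h k) => [x /=|].
  by rewrite EFinD leeD2r.
by rewrite -kE; exact: sintegralD.
Qed.

End superadditivity.

(** * Borel measurability and Haar measure *)

Section borel_lemmas.
Variable R : realType.

Lemma borel_open (H : PreTopologicalZmodule.type) (U : set H) :
  open U -> measurable (U : set (borel H)).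
Proof. by move=> oU; exact: sub_sigma_algebra. Qed.

Lemma continuous_borel_fun (H K : PreTopologicalZmodule.type) (f : H -> K) :
  continuous f -> measurable_fun setT (f : borel H -> borel K).
Proof.
move=> cf; apply: (@measurability _ _ (borel H) (borel K) setT f (@open K)) => //.
move=> _ [U oU <-]; rewrite setTI; apply: borel_open.
by have /continuousP := cf; apply.
Qed.

Lemma continuous_borel_real (H : PreTopologicalZmodule.type) (f : H -> R) :
  continuous f -> measurable_fun setT (f : borel H -> R).
Proof.
move=> cf; apply: (measurability _ (RGenOInfty.measurableE R)) => //.
move=> _ [_ [a ->] <-]; rewrite setTI; apply: borel_open.
have /continuousP := cf; apply; exact: interval_open.
Qed.

Lemma continuous_Re : continuous (@complex.Re R : R[i]^o -> R).
Proof.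
move=> z; apply: (@cvgrPdist_lt R R _ (nbhs (z : R[i]^o)) _ _ _).2 => e e0.
have : \forall w \near (z : R[i]^o), `|z - w| < (e%:C)%C.
  apply: (@cvgr_dist_lt _ R[i]^o _ (nbhs (z : R[i]^o)) _ id z cvg_id).
  by rewrite ltcR.
apply: filterS => w; rewrite normc_def ltcR; apply: le_lt_trans.
case: z w => [a b] [u v] /=.
by rewrite -sqrtr_sqr ler_sqrt ?addr_ge0 ?sqr_ge0// lerDl sqr_ge0.
Qed.

Lemma continuous_Im : continuous (@complex.Im R : R[i]^o -> R).
Proof.
move=> z; apply: (@cvgrPdist_lt R R _ (nbhs (z : R[i]^o)) _ _ _).2 => e e0.
have : \forall w \near (z : R[i]^o), `|z - w| < (e%:C)%C.
  apply: (@cvgr_dist_lt _ R[i]^o _ (nbhs (z : R[i]^o)) _ id z cvg_id).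
  by rewrite ltcR.
apply: filterS => w; rewrite normc_def ltcR; apply: le_lt_trans.
case: z w => [a b] [u v] /=.
by rewrite -sqrtr_sqr ler_sqrt ?addr_ge0 ?sqr_ge0// lerDr sqr_ge0.
Qed.

Lemma continuous_cmeasurable (H : PreTopologicalZmodule.type) (f : H -> R[i]) :
  continuous (f : H -> R[i]^o) -> cmeasurable (f : borel H -> R[i]).
Proof.
move=> cf; split.
- apply: continuous_borel_real => x.
  by apply: (@continuous_comp _ _ _ (f : H -> R[i]^o));
    [exact: cf|exact: continuous_Re].
- apply: continuous_borel_real => x.
  by apply: (@continuous_comp _ _ _ (f : H -> R[i]^o));
    [exact: cf|exact: continuous_Im].
Qed.

End borel_lemmas.

Section translation.
Variables (R : realType) (G : topologicalZmodType).
Variables (mu : {measure set (borel G) -> \bar R}).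
Hypothesis mu_haar : is_haar mu.

Lemma shift_continuous (x : G) : continuous (fun t : G => t - x).
Proof.
move=> t; apply: (@continuous_comp _ _ _ (fun u : G => (u, - x))
  (fun z : G * G => z.1 + z.2)); last exact: add_continuous.
by apply: cvg_pair => /=; [exact: cvg_id|exact: cvg_cst].
Qed.

Lemma shift_measurable (x : G) :
  measurable_fun setT (fun t : borel G => ((t : G) - x : borel G)).
Proof. exact: (@continuous_borel_fun G G _ (@shift_continuous x)). Qed.

Lemma haar_shift (x : G) (A : set (borel G)) : measurable A ->
  mu ((fun t : borel G => ((t : G) - x : borel G)) @^-1` A) = mu A.
Proof.
have [inv _ _] := mu_haar => mA; rewrite -(inv x A mA); congr (mu _).
apply/seteqP; split => [t /= At|t [y Ay <-]] /=.
  by exists (t - x) => //; rewrite addrC subrK.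
by rewrite addrC addKr.
Qed.

End translation.

(** Intersect a relatively compact open neighborhood of 0 with its opposite. *)
Lemma haar_window (R : realType) (G : topologicalZmodType)
    (mu : {measure set (borel G) -> \bar R}) :
  locally_compact [set: G] -> is_haar mu ->
  exists K : set G, [/\ open K, forall x, K (- x) <-> K x,
    (0 < mu K)%E & (mu K < +oo)%E].
Proof.
move=> lcG [_ mufin mupos].
have [B wB [cB clB]] := lcG 0 I.
have B0 : nbhs (0 : G) B.
  by apply: (@filterS _ (nbhs (0 : G)) _ _ _ _ wB) => x; apply.
have [V [oV V0] VU] : exists2 V, open_nbhs (0 : G) V & V `<=` B.
  by move: B0; rewrite nbhsE.
have oN : open (-%R @^-1` V : set G).
  by have /continuousP := @opp_continuous G; apply.
exists (V `&` -%R @^-1` V); split.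
- exact: openI.
- by move=> x; rewrite /setI /preimage /= opprK; split => -[].
- by apply: mupos; [exact: openI|exists 0; split => //=; rewrite oppr0].
- apply: (le_lt_trans _ (mufin _ cB)); apply: le_measure.
  + apply: mem_set; exact: (@borel_open G _ (openI oV oN)).
  + apply: mem_set; rewrite -[B]setCK; apply: measurableC.
    exact: (@borel_open G _ (closed_openC clB)).
  + by move=> x [Vx _]; exact: VU.
Qed.

(** * Joint measurability on second countable groups *)

Section measurability.
Variable R : realType.

(** A possibly repeating enumeration also covers finite bases. *)
Lemma second_countable_seq (G : topologicalType) : @second_countable G ->
  exists b : nat -> set G, (forall n, open (b n)) /\
    forall x U, nbhs x U -> exists2 n, b n x & b n `<=` U.
Proof.
move=> [B cB [Bo Bb]].
move: cB => /pfcard_geP[B0|[b]].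
  exists (fun _ => set0); split=> [_|x U xU]; first exact: open0.
  by have [V [] /=] := Bb x _ xU; rewrite B0.
exists b; split=> [n|x U xU]; first by apply: Bo; exact: funS.
have [V [/= BV Vx] VU] := Bb x _ xU.
have [n _ bn] : (b @` setT) V by exact: surj BV.
by exists n; rewrite bn.
Qed.

(** A function that is continuous in the first variable and measurable in the
    second is jointly measurable. The superlevel set F > a is the union, over
    k and over basic open sets b, of the products of b with the set of t such that
    F (y, t) >= a + 1/(k+1) for the y in a countable dense subset of b. *)
Lemma caratheodory_measurable (G : PreTopologicalZmodule.type) d
    (T : measurableType d) (F : borel G * T -> R) : @second_countable G ->
  (forall t, continuous (fun x : G => F (x, t))) ->
  (forall x, measurable_fun setT (fun t => F (x, t))) ->
  measurable_fun setT F.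
Proof.
move=> /second_countable_seq[b [bo bb]] cF mF.
(* The points p n form a countable dense set. *)
have [p bp] : exists p : nat -> G, forall n x, b n x -> b n (p n).
  have /choice[p bp] : forall n, exists y, forall x, b n x -> b n y.
    move=> n; have [[y by_]|b0] := pselect (exists y, b n y).
      by exists y.
    by exists 0 => x bx; exfalso; apply: b0; exists x.
  by exists p.
apply: (measurability _ (RGenOInfty.measurableE R)) => //.
move=> _ [_ [a ->] <-]; rewrite setTI.
pose A k n := [set w : T | forall m, b n (p m) -> a + k.+1%:R^-1 <= F (p m, w)].
have -> : F @^-1` [set` `]a, +oo[] =
    \bigcup_k \bigcup_n ((b n : set (borel G)) `*` A k n).
  apply/seteqP; split=> [[x w]|[x w] [k _ [n _ [/= bnx Aw]]]].
    rewrite /= in_itv/= andbT => aF.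
    have [k kF] := ltr_add_invr aF.
    have [|n bnx bnU] := bb x [set y | a + k.+1%:R^-1 < F (y, w)].
      exact: (cF w x _ (lt_nbhsr kF)).
    by exists k => //; exists n => //; split=> //= m /bnU /= /ltW.
  rewrite /= in_itv/= andbT ltNge; apply/negP => Fa.
  have [|m bmx bmU] := bb x ([set y | F (y, w) < a + k.+1%:R^-1] `&` b n).
    apply: filterI; last by apply: open_nbhs_nbhs.
    have Fk : F (x, w) < a + k.+1%:R^-1.
      by rewrite (le_lt_trans Fa)// ltrDl invr_gt0.
    exact: (cF w x _ (lt_nbhsl Fk)).
  have /bmU[/= Fp bp'] := bp _ _ bmx.
  by have := Aw m bp'; rewrite leNgt Fp.
apply: bigcupT_measurable => k; apply: bigcupT_measurable => n.
apply: measurableX; first exact: borel_open.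
rewrite (_ : A k n =
    \bigcap_m [set w : T | b n (p m) -> a + k.+1%:R^-1 <= F (p m, w)]); last first.
  by apply/seteqP; split => [w Aw m _|w Aw m]; [exact: Aw|exact: (Aw m I)].
apply: bigcapT_measurable => m.
have [bm|nbm] := pselect (b n (p m)); last first.
  by rewrite (_ : [set _ | _] = setT)//; apply/seteqP; split => w //= _ /nbm.
rewrite (_ : [set _ | _] = (fun t => F (p m, t)) @^-1` `[a + k.+1%:R^-1, +oo[%classic).
  by rewrite -[X in measurable X]setTI; exact: mF.
apply/seteqP; split => w /=; rewrite in_itv/= andbT; first exact.
by [].
Qed.

(** The product sigma-algebra of the Borel sets contains the Borel sets of the
    product because the topology has a countable basis of rectangles. *)
Lemma open_product_measurable (G : PreTopologicalZmodule.type) (W : set (G * G)) :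
  @second_countable G -> open W -> measurable (W : set (borel G * borel G)).
Proof.
move=> /second_countable_seq[b [bo bb]] oW.
pose A n m : set (borel G * borel G) :=
  if `[< b n `*` b m `<=` W >] then b n `*` b m else set0.
rewrite (_ : W = \bigcup_n \bigcup_m A n m).
  apply: bigcupT_measurable => n; apply: bigcupT_measurable => m.
  by rewrite /A; case: ifPn => // _; apply: measurableX; exact: borel_open.
apply/seteqP; split => [[x y] Wxy|[x y] [n _ [m _]]]; last first.
  by rewrite /A; case: ifPn => // /asboolP; apply.
have /= [[U V] /= [xU yV] UVW] : nbhs (x, y) W by exact: open_nbhs_nbhs.
have [n bnx bnU] := bb x U xU; have [m bmy bmV] := bb y V yV.
exists n => //; exists m => //; rewrite /A asboolT//.
by move=> [u v] [/= /bnU Uu /bmV Vv]; apply: UVW.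
Qed.

Variable G : topologicalZmodType.

(** Evaluation at t is continuous for the compact-open topology since the
    singleton of t is compact. *)
Lemma dual_eval_continuous (t : G) :
  continuous ((fun w : dual R G => w t) : dual R G -> R[i]^o).
Proof.
apply/continuousP => O oO.
rewrite (_ : _ @^-1` _ =
    ((@dual_fun R G) : dual R G -> {compact-open, G -> R[i]^o}) @^-1`
      [set g | g @` [set t] `<=` O]).
  have /continuousP := @initial_continuous (dual R G) _
    ((@dual_fun R G) : dual R G -> {compact-open, G -> R[i]^o}); apply.
  by apply: compact_open_open => //; exact: compact_set1.
apply/seteqP; split => w /=; first by move=> Ow _ [_ -> <-].
by apply; exists t.
Qed.

Lemma dual_eval_measurable : @second_countable G ->
  cmeasurable (fun z : borel G * borel (dual R G) => (z.2 : dual R G) z.1).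
Proof.
move=> sG; split; apply: caratheodory_measurable => //= [w t|t].
- have [cw _ _] := dualP w.
  by apply: (@continuous_comp _ _ _ (w : G -> R[i]^o));
    [exact: cw|exact: continuous_Re].
- by have [] := continuous_cmeasurable (@dual_eval_continuous t).
- have [cw _ _] := dualP w.
  by apply: (@continuous_comp _ _ _ (w : G -> R[i]^o));
    [exact: cw|exact: continuous_Im].
- by have [] := continuous_cmeasurable (@dual_eval_continuous t).
Qed.

End measurability.

(** * Orthogonality relations for the short-time Fourier transform *)

(** Tonelli's theorem applied to the positive and negative parts; the default
    value of a divergent integral does not harm measurability. *)
Lemma parametric_cintegral_measurable d1 d2 (T1 : measurableType d1)
    (T2 : measurableType d2) (R : realType)
    (m2 : {sigma_finite_measure set T2 -> \bar R}) (F : T1 * T2 -> R[i]) :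
  cmeasurable F -> cmeasurable (fun x => cintegral m2 (fun y => F (x, y))).
Proof.
have H (u : T1 * T2 -> R) : measurable_fun setT u ->
    measurable_fun setT (fun x => Rintegral m2 setT (fun y => u (x, y))).
  move=> mu_; apply: measurableT_comp => //.
  under eq_fun do rewrite integralE.
  apply: emeasurable_funB.
  - under eq_fun do under eq_integral do rewrite funeposE.
    apply: (@measurable_fun_fubini_tonelli_F _ _ _ _ _ m2
      (fun z => maxe (u z)%:E 0)) => [|z]; last by rewrite le_max lexx orbT.
    by apply: measurable_maxe => //; exact/measurable_EFinP.
  - under eq_fun do under eq_integral do rewrite funenegE.
    apply: (@measurable_fun_fubini_tonelli_F _ _ _ _ _ m2
      (fun z => maxe (- (u z)%:E) 0)%E) => [|z]; last by rewrite le_max lexx orbT.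
    apply: measurable_maxe => //; apply: measurableT_comp => //.
    exact/measurable_EFinP.
by move=> [F1 F2]; split; [exact: (H _ F1)|exact: (H _ F2)].
Qed.

Section moyal.
Variables (R : realType) (G : topologicalZmodType).
Hypothesis G_second_countable : @second_countable G.
Variables (mu : {sigma_finite_measure set (borel G) -> \bar R}).
Variables (nu : {sigma_finite_measure set (borel (dual R G)) -> \bar R}).
Hypotheses (mu_haar : is_haar mu) (mu_nu_plancherel : plancherel mu nu).
Variable K : set G.
Hypotheses (K_open : open K) (K_sym : forall x, K (- x) <-> K x).
Hypothesis K_fin : (mu K < +oo)%E.
Local Notation C := R[i].

Definition window (t : G) : C := ((\1_K t : R)%:C)%C.

Lemma indic_sym (x : G) : \1_K (- x) = \1_K x :> R.
Proof.
by rewrite !indicE; congr (_%:R); congr (nat_of_bool _); apply/idP/idP;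
  rewrite !inE => /K_sym.
Qed.

Lemma cmeasurable_indic_shift :
  measurable_fun setT (fun z : borel G * borel G => \1_K ((z.2 : G) - z.1 : G) : R).
Proof.
pose W := [set z : G * G | K (z.2 - z.1)].
rewrite (_ : (fun _ => _) = \1_(W : set (borel G * borel G))).
  apply: measurable_indic; apply: open_product_measurable => //.
  apply: (@open_comp _ _ (fun z : G * G => z.2 - z.1)) => // z _.
  apply: (@continuous_comp _ _ _ (fun u : G * G => (u.2, - u.1))
    (fun u : G * G => u.1 + u.2)); last exact: add_continuous.
  apply: cvg_pair => /=; first exact: cvg_snd.
  by apply: (@continuous_comp _ _ _ fst (-%R : G -> G));
    [exact: cvg_fst|exact: opp_continuous].
by apply/funext => z; rewrite !indicE /W; congr (_%:R); congr (nat_of_bool _);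
  apply/idP/idP; rewrite !inE.
Qed.

Lemma window_energy : energy mu window = mu K.
Proof.
rewrite /energy (eq_integral (fun x => (\1_(K : set (borel G)) x : R)%:E)) => [|x _].
  by rewrite integral_indic ?setIT//; exact: borel_open.
by rewrite /sqn /window/= expr0n/= addr0 indicE; case: (_ \in _);
  rewrite ?expr1n ?expr0n.
Qed.

Lemma window_L2 : L2 mu window.
Proof.
apply/L2E; split; last by rewrite window_energy.
split => /=; last exact: measurable_cst.
by apply: measurable_indic; exact: borel_open.
Qed.

Lemma stft_measurable f : L2 mu f ->
  cmeasurable (fun xi : borel G * borel (dual R G) => stft mu window f xi).
Proof.
move=> [mf _].
apply: (@parametric_cintegral_measurable _ _ _ _ _ mu (fun z :
  (borel G * borel (dual R G)) * borel G =>
  f z.2 * ((z.1.2 : dual R G) z.2 * window ((z.2 : G) - z.1.1))^*%C)).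
apply: cmeasurableM; first exact: (cmeasurable_comp mf measurable_snd).
pose X := ((borel G * borel (dual R G)) * borel G)%type.
apply: cmeasurableJ; apply: cmeasurableM.
  have := cmeasurable_comp (@dual_eval_measurable R G G_second_countable)
    (_ : measurable_fun setT (fun z : X => (z.2, z.1.2))).
  apply; by apply: measurable_fun_pair => //; exact: measurableT_comp.
split => /=; last exact: measurable_cst.
have := measurableT_comp cmeasurable_indic_shift
  (_ : measurable_fun setT (fun z : X => (z.1.1, z.2))).
apply; apply: measurable_fun_pair => //; exact: measurableT_comp.
Qed.

Lemma window_shift_L2 (x : G) : L2 mu (fun t => window (t - x)).
Proof.
apply: (@L2_comp _ _ _ mu (fun t : borel G => ((t : G) - x : borel G))).
- exact: shift_measurable.
- by move=> A mA; exact: haar_shift.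
- exact: window_L2.
Qed.

(** In L^1 because both factors are in L^2, and in L^2 because the window is
    bounded by 1. *)
Lemma window_mulL2 f x : L2 mu f ->
  L1 mu (fun t => f t * window (t - x)) /\ L2 mu (fun t => f t * window (t - x)).
Proof.
move=> Lf; have [mf _] := Lf; have Lw := window_shift_L2 x; have [mw _] := Lw.
have mfw := cmeasurableM mf mw.
have w01 t : sqn (window t) <= 1.
  by rewrite /sqn /window/= expr0n addr0 indicE; case: (_ \in _);
    rewrite ?expr1n ?expr0n ?ler01.
split; split => //.
- rewrite /cnorm Lnorm1.
  have /integrableP[_] : mu.-integrable setT
      (fun t => (Normc.normc (f t * window (t - x)))%:E).
    apply: (@integrable_le_sqn _ _ _ _ _ f (fun t => window (t - x))) => //.
    - rewrite (_ : (fun _ => _) = (fun t => Num.sqrt (sqn (f t * window (t - x))))).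
        exact: (measurableT_comp (continuous_measurable_fun (@sqrt_continuous R))
          (measurable_sqnR mfw)).
      by apply/funext => t; rewrite /sqn; case: (_ * _).
    - move=> t; rewrite Normc.normcM -!sqr_normc_sqn.
      move: (Normc.normc _) (Normc.normc _) => a b.
      have := sqr_ge0 (a + b); have := sqr_ge0 (a - b).
      rewrite !sqrrD sqrrN ler_norml => *; apply/andP; split; nra.
  by [].
- suff: L2 mu (fun t => f t * window (t - x)) by case.
  apply/L2E; split=> //; have /L2E[_] := Lf; apply: le_lt_trans.
  apply: ge0_le_integral => //.
  + by move=> t _; rewrite lee_fin sqn_ge0.
  + exact: measurable_sqn.
  + exact: measurable_sqn.
  + move=> t _; rewrite lee_fin sqnM -[leRHS]mulr1.
    by rewrite ler_wpM2l ?sqn_ge0.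
Qed.

Lemma energy_fourier f : L1 mu f -> L2 mu f ->
  energy nu (fourier mu f) = energy mu f.
Proof.
move=> L1f L2f; have := mu_nu_plancherel L1f L2f; rewrite !cnorm2E.
move=> /(congr1 (fun x => x `^ 2)%E); rewrite -!poweRrM.
by rewrite mulVf ?pnatr_eq0// !poweRe1// energy_ge0.
Qed.

(** The window is real-valued, so no conjugate appears on the right. *)
Lemma stft_fourier f x w :
  stft mu window f (x, w) = fourier mu (fun t => f t * window (t - x)) w.
Proof.
rewrite /stft /fourier /ip /tfshift /=; congr cintegral; apply/funext => t.
rewrite /window; move: (\1_K _ : R) (f t) (w t) => r [a b] [u v].
by apply/eqP; rewrite eq_complex /=; apply/andP; split; apply/eqP; ring.
Qed.

(** At fixed x, Plancherel's formula turns the integral over the dual group into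
    that of |f(t)|^2 h(t - x) over t. Exchanging the order of integration leaves
    the integral of h(t - x) over x, which is the measure of K by symmetry and
    translation invariance. *)
Lemma moyal f : L2 mu f ->
  (\int[(mu \x nu)%E]_xi (sqn (stft mu window f xi))%:E = energy mu f * mu K)%E.
Proof.
move=> Lf; have [mf ef] := Lf.
rewrite (fubini_tonelli1 (fun xi : borel G * borel (dual R G) =>
  (sqn (stft mu window f xi))%:E)); last 2 first.
- exact/measurable_sqn/stft_measurable.
- by move=> xi; rewrite lee_fin sqn_ge0.
pose k (z : borel G * borel G) := (sqn (f z.2) * \1_K ((z.2 : G) - z.1 : G))%:E.
have mk : measurable_fun setT k.
  apply/measurable_EFinP/measurable_funM; last exact: cmeasurable_indic_shift.
  by apply: (measurableT_comp (measurable_sqnR mf)).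
have k0 z : (0 <= k z)%E by rewrite lee_fin mulr_ge0 ?sqn_ge0.
transitivity (\int[mu]_x \int[mu]_t k (x, t))%E.
  apply: eq_integral => x _; rewrite /fubini_F.
  have [L1fw L2fw] := window_mulL2 x Lf.
  transitivity (energy nu (fourier mu (fun t => f t * window (t - x)))).
    by apply: eq_integral => w _; rewrite stft_fourier.
  rewrite energy_fourier//; apply: eq_integral => t _.
  rewrite /k sqnM /=; congr (_ * _)%:E.
  by rewrite /sqn /window/= expr0n/= addr0 indicE; case: (_ \in _);
    rewrite ?expr1n ?expr0n.
rewrite (fubini_tonelli k)//.
rewrite /energy -ge0_integralZr//; last 2 first.
- exact: measurable_sqn.
- by move=> t _; rewrite lee_fin sqn_ge0.
apply: eq_integral => t _; rewrite /fubini_G /k /=.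
under eq_integral do rewrite EFinM -indic_sym opprB.
rewrite ge0_integralZl_EFin ?sqn_ge0//; last first.
  apply/measurable_EFinP.
  apply: (measurableT_comp (_ : measurable_fun setT (\1_(K : set (borel G)) : _ -> R))).
    by apply: measurable_indic; exact: borel_open.
  exact: shift_measurable.
congr (_ * _)%E.
rewrite (ge0_integral_comp (shift_measurable (t : G)) _
  (f := fun y => (\1_(K : set (borel G)) y)%:E))//.
- by rewrite integral_indic ?setIT//; exact: borel_open.
- by move=> A mA; exact: haar_shift.
- by apply/measurable_EFinP/measurable_indic; exact: borel_open.
Qed.

End moyal.

(** * Symmetric biadditive forms and unsummable windows *)

(** Forms are only required to be additive on the vectors that satisfy P, which
    will be square integrability. *)
Section symmetric_form.
Variables (R : realType) (V : zmodType) (P : V -> Prop) (b : V -> V -> R).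
Hypothesis PB : forall x y, P x -> P y -> P (x - y).
Hypothesis PD : forall x y, P x -> P y -> P (x + y).
Hypothesis bC : forall x y, b x y = b y x.
Hypothesis bD : forall x y z, P x -> P y -> P z -> b x (y + z) = b x y + b x z.

Lemma symform_sqrD x y : P x -> P y ->
  b (x + y) (x + y) = b x x + 2 * b x y + b y y.
Proof.
move=> Px Py; have Pxy := PD Px Py.
by rewrite bD// (bC _ x) (bC _ y) !bD// (bC y x); ring.
Qed.

Lemma symform_par x y : P x -> P y ->
  b (x + y) (x + y) + b (x - y) (x - y) = 2 * (b x x + b y y).
Proof.
move=> Px Py; have Pxy := PB Px Py.
have := symform_sqrD Pxy Py; have := bD Py Pxy Py.
rewrite !subrK (symform_sqrD Px Py) (bC y (x - y)) (bC y x); lra.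
Qed.

End symmetric_form.

(** A symmetric form is determined by its quadratic form. *)
Lemma symform_ext (R : realType) (V : zmodType) (P : V -> Prop) (b b' : V -> V -> R) :
  (forall x y, P x -> P y -> P (x + y)) ->
  (forall x y, b x y = b y x) -> (forall x y, b' x y = b' y x) ->
  (forall x y z, P x -> P y -> P z -> b x (y + z) = b x y + b x z) ->
  (forall x y z, P x -> P y -> P z -> b' x (y + z) = b' x y + b' x z) ->
  (forall x, P x -> b x x = b' x x) ->
  forall x y, P x -> P y -> b x y = b' x y.
Proof.
move=> PD bC b'C bD b'D bb' x y Px Py.
have := bb' _ (PD _ _ Px Py).
rewrite (symform_sqrD PD bC bD Px Py) (symform_sqrD PD b'C b'D Px Py) !bb'//; lra.
Qed.

(** In the application V consists of rows of functions, Q i x is the squared l^2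
    norm of the coefficients of x for the window i if it is finite and 0 otherwise,
    and D i is the domain of finiteness. The sum of the Q i is a quadratic form,
    whereas each Q i is one only on D i. *)
Section unsummable_vanish.
Variables (R : realType) (V : zmodType) (I : finType) (P : V -> Prop).
Variables (D : I -> V -> Prop) (Q : I -> V -> R).
Hypothesis PD : forall x y, P x -> P y -> P (x + y).
Hypothesis PB : forall x y, P x -> P y -> P (x - y).
Hypothesis DB : forall i x y, P x -> P y -> D i x -> D i y -> D i (x - y).
Hypothesis DMn : forall i x n, P x -> D i (x *+ n.+1) <-> D i x.
Hypothesis Q_ge0 : forall i x, 0 <= Q i x.
Hypothesis Q_notD : forall i x, ~ D i x -> Q i x = 0.
Hypothesis Q_par : forall i x y, P x -> P y -> D i x -> D i y ->
  Q i (x + y) + Q i (x - y) = 2 * (Q i x + Q i y).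
Hypothesis sumQ_par : forall x y, P x -> P y ->
  \sum_i Q i (x + y) + \sum_i Q i (x - y) = 2 * (\sum_i Q i x + \sum_i Q i y).

Let PMn x n : P x -> P (x *+ n).
Proof.
move=> Px; elim: n => [|n Pn]; first by rewrite mulr0n -(subrr x); exact: PB.
by rewrite mulrS; exact: PD.
Qed.

(** If two of the vectors y + k x with different k were in D i, then so would be
    x, and then y. *)
Let generic1 i x y : P x -> P y -> ~ D i y -> exists N0, forall N, (N0 <= N)%N ->
  ~ D i (y + x *+ N.+1).
Proof.
move=> Px Py nDy.
have [[N0 DN0]|H] := pselect (exists N, D i (y + x *+ N.+1)); last first.
  by exists 0%N => N _ DN0; apply: H; exists N.
exists N0.+1 => N N0N DN1; apply: nDy.
have Dx : D i x.
  apply/(@DMn i x (N - N0).-1) => //.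
  rewrite prednK ?subn_gt0//.
  rewrite (_ : x *+ (N - N0) = (y + x *+ N.+1) - (y + x *+ N0.+1)).
    by apply: DB => //; apply: PD => //; exact: PMn.
  by rewrite opprD addrACA subrr add0r -mulrnBr ?subSS// ltnS ltnW.
rewrite -(addrK (x *+ N.+1) y); apply: DB => //.
- by apply: PD => //; exact: PMn.
- exact: PMn.
- exact/DMn.
Qed.

Let PN x : P x -> P (- x).
Proof.
by move=> Px; rewrite -sub0r; apply: PB => //; rewrite -(subrr x); exact: PB.
Qed.

Let generic x y : P x -> P y -> exists N, forall i, ~ D i y ->
  ~ D i (y + x *+ N.+1) /\ ~ D i (y - x *+ N.+1).
Proof.
move=> Px Py.
have /choice[k kP] : forall i, exists N0, forall N, (N0 <= N)%N -> ~ D i y ->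
    ~ D i (y + x *+ N.+1) /\ ~ D i (y - x *+ N.+1).
  move=> i; have [Dy|nDy] := pselect (D i y); first by exists 0%N.
  have [N1 H1] := generic1 Px Py nDy; have [N2 H2] := generic1 (PN Px) Py nDy.
  exists (maxn N1 N2) => N; rewrite geq_max => /andP[N1N N2N] _; split; first exact: H1.
  by rewrite -mulNrn; exact: H2.
exists (\max_i k i)%N => i; apply: kP; exact: leq_bigmax.
Qed.

(** Replace x by a multiple z such that y + z and y - z lie in no D j that y is
    not in. Then, for every j, the parallelogram law of Q j for y and z holds with
    an inequality. The inequalities add up to an equality, so each is one; for
    j = i, with y in D i, neither z nor y + z nor y - z is in D i, and the
    equality reads 0 = 2 Q i y. *)
Lemma unsummable_vanish i x y : P x -> P y -> ~ D i x -> Q i y = 0.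
Proof.
move=> Px Py nDx; have [N yN] := generic Px Py.
set z := x *+ N.+1 in yN; have Pz : P z by exact: PMn.
have term j : 0 <= 2 * (Q j y + Q j z) - (Q j (y + z) + Q j (y - z)).
  have [Dy|nDy] := pselect (D j y); last first.
    have [n1 n2] := yN _ nDy; rewrite !(Q_notD n1) !(Q_notD n2) addr0 subr0.
    by rewrite mulr_ge0// addr_ge0.
  have [Dz|nDz] := pselect (D j z); first by rewrite Q_par// subrr.
  rewrite (@Q_notD j (y + z)); last first.
    move=> Dyz; apply: nDz; rewrite -(addrK y z) [z + y]addrC.
    apply: DB => //; exact: PD.
  rewrite (@Q_notD j (y - z)); last first.
    move=> Dyz; apply: nDz; rewrite -(subKr y z); apply: DB => //; exact: PB.
  by rewrite addr0 subr0 mulr_ge0// addr_ge0.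
have sum0 : \sum_j (2 * (Q j y + Q j z) - (Q j (y + z) + Q j (y - z))) = 0.
  by rewrite sumrB -mulr_sumr !big_split /= sumQ_par// subrr.
have /(_ i isT) := psumr_eq0P (fun j _ => term j) sum0.
have nDz : ~ D i z by move=> /(DMn i N Px).
have [Dy|nDy] := pselect (D i y); last by rewrite (Q_notD nDy).
rewrite (Q_notD nDz) (@Q_notD i (y + z)); last first.
  move=> Dyz; apply: nDz; rewrite -(addrK y z) [z + y]addrC.
  apply: DB => //; exact: PD.
rewrite (@Q_notD i (y - z)); last first.
  move=> Dyz; apply: nDz; rewrite -(subKr y z); apply: DB => //; exact: PB.
by rewrite !addr0 subr0 => /eqP; rewrite mulf_eq0 pnatr_eq0/= => /eqP.
Qed.

End unsummable_vanish.

(** * Counting measure on the lattice *)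

Section counting_lattice.
Variables (R : realType) (P : PreTopologicalZmodule.type) (L : zmodClosed P).
Local Notation T := (lattice_mtype L).
Local Notation cnt := (@counting T R).
Local Notation C := R[i].

Lemma lattice_measurable (A : set T) : measurable A.
Proof. exact: sub_sigma_algebra. Qed.

Lemma lattice_measurable_fun d (U : measurableType d) (f : T -> U) :
  measurable_fun setT f.
Proof. by move=> _ A _; exact: lattice_measurable. Qed.

Lemma lattice_cmeasurable (f : T -> C) : cmeasurable f.
Proof. by split; exact: lattice_measurable_fun. Qed.

Lemma counting_bij (f f' : T -> T) (A : set T) : cancel f f' -> cancel f' f ->
  cnt (f @^-1` A) = cnt A.
Proof.
move=> fK f'K; have fA : A = f @` (f @^-1` A).
  apply/seteqP; split=> [x Ax|_ [x /= Ax <-]//].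
  by exists (f' x) => /=; rewrite f'K.
rewrite {2}fA /counting; have [fin|inf] := pselect (finite_set (f @^-1` A)).
  rewrite !asboolT//; last exact: finite_image.
  by rewrite fset_set_image// finmap.card_imfset//; exact: can_inj fK.
rewrite !asboolF// => fin; apply: inf.
by rewrite (_ : f @^-1` A = f' @` (f @` (f @^-1` A)));
  [exact: finite_image|rewrite image_comp; apply/seteqP; split=> [x Ax|_ [x Ax <-]] /=;
  [exists x => //=|]; rewrite fK].
Qed.

(** Counting measure dominates the mass of one point. *)
Lemma energy_point (a : T -> C) (x : T) : ((sqn (a x))%:E <= energy cnt a)%E.
Proof.
rewrite /energy.
have -> : ((sqn (a x))%:E = \int[cnt]_(y in [set x]) (sqn (a y))%:E)%E.
  rewrite (eq_integral (cst (sqn (a x))%:E)) => [|y /set_mem ->//].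
  rewrite integral_cst//; last exact: lattice_measurable.
  rewrite -[LHS]mule1; congr (_ * _)%E; change (1%E = cnt [set x]).
  by rewrite /counting asboolT//= fset_set1 finmap.cardfs1.
apply: ge0_subset_integral.
- exact: lattice_measurable.
- exact: measurableT.
- exact: (measurable_sqn (lattice_cmeasurable a)).
- by move=> y _; rewrite lee_fin sqn_ge0.
- by [].
Qed.

End counting_lattice.

(** * Time-frequency shifts *)

Section shifts.
Variables (R : realType) (G : topologicalZmodType).
Variables (mu : {measure set (borel G) -> \bar R}).
Hypothesis mu_haar : is_haar mu.
Local Notation C := R[i].
Local Notation phase := (phase_space R G).
Implicit Types (w v : dual R G) (xi eta : phase) (f g : G -> C).

Lemma charD w x y : w (x + y) = w x * w y.
Proof. by have [_ _] := dualP w. Qed.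

Lemma char_sqn w x : sqn (w x) = 1.
Proof. by have [_ w1 _] := dualP w; exact: sqn_eq1. Qed.

Lemma char_conj w x : w x * (w x)^*%C = 1.
Proof. by rewrite sqn_conj char_sqn. Qed.

Lemma char_neq0 w x : w x != 0.
Proof.
apply/eqP => w0; have := char_conj w x.
by rewrite w0 mul0r => /esym/eqP; rewrite oner_eq0.
Qed.

Lemma char0 w : w 0 = 1.
Proof. by apply: (mulfI (char_neq0 w 0)); rewrite mulr1 -charD addr0. Qed.

Lemma charN w x : w (- x) = (w x)^*%C.
Proof.
by apply: (mulfI (char_neq0 w x)); rewrite char_conj -charD subrr char0.
Qed.

Lemma tfshift_L2 xi f : L2 mu f -> L2 mu (tfshift xi f).
Proof.
case: xi => x w Lf.
have /L2E[ms es] : L2 mu (fun t => f (t - x)).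
  apply: (@L2_comp _ _ _ mu (fun t : borel G => ((t : G) - x : borel G))) => //.
  - exact: shift_measurable.
  - by move=> A mA; exact: haar_shift.
have mw : cmeasurable (w : borel G -> C).
  by apply: continuous_cmeasurable; have [] := dualP w.
apply/L2E; split; first exact: cmeasurableM.
rewrite [X in (X < _)%E](_ : _ = energy mu (fun t : borel G => f ((t : G) - x)))//.
by apply: eq_integral => t _; rewrite /tfshift /= sqnM char_sqn mul1r.
Qed.

Lemma ip_tfshift xi f g : L2 mu f -> L2 mu g ->
  ip mu (tfshift xi f) (tfshift xi g) = ip mu f g.
Proof.
case: xi => x w [mf _] [mg _].
rewrite /ip -(@cintegral_comp _ _ _ mu _ (shift_measurable x)
  (fun A => @haar_shift _ _ _ mu_haar x A) (fun t => f t * (g t)^*%C)); last first.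
  by apply: cmeasurableM => //; exact: cmeasurableJ.
congr cintegral; apply/funext => t; rewrite /tfshift /=.
rewrite (_ : (w t * g (t - x))^*%C = (w t)^*%C * (g (t - x))^*%C); last exact: rmorphM.
by rewrite mulrACA char_conj mul1r.
Qed.

(** The projective representation: the phase comes from commuting a translation
    with a modulation. *)
Lemma tfshiftD xi eta f : tfshift xi (tfshift eta f) =
  (fun t => (eta.2 xi.1)^*%C * tfshift (xi + eta) f t).
Proof.
case: xi eta => x w [y v]; apply/funext => t; rewrite /tfshift /=.
by rewrite charD charN opprD addrA; ring.
Qed.

Lemma tfshift0 f : tfshift (0 : phase) f = f.
Proof. by apply/funext => t; rewrite /tfshift /= subr0 mul1r. Qed.

(** The opposite shift inverts a shift up to a phase. *)
Lemma tfshift_onto xi f : L2 mu f -> exists2 f', L2 mu f' & f = tfshift xi f'.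
Proof.
move=> Lf; pose c := (- xi).2 xi.1; exists (fun t => c * tfshift (- xi) f t).
  by apply: L2Z; exact: tfshift_L2.
transitivity (fun t => c * tfshift xi (tfshift (- xi) f) t).
  by rewrite tfshiftD subrr tfshift0; apply/funext => t; rewrite mulrA char_conj mul1r.
by apply/funext => t; rewrite /tfshift mulrCA.
Qed.

End shifts.

(** * Analysis maps on rows *)

Section rows.
Variables (R : realType) (G : topologicalZmodType).
Variables (mu : {measure set (borel G) -> \bar R}).
Hypothesis mu_haar : is_haar mu.
Variable L : zmodClosed (phase_space R G).
Local Notation C := R[i].
Local Notation cnt := (@counting (lattice_mtype L) R).
Variable d : nat.
Implicit Types (phi psi p q : 'I_d -> G -> C).

Definition rowL2 phi := forall m, L2 mu (phi m).
Definition rowip phi psi : C := \sum_m ip mu (phi m) (psi m).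
Definition rowshift (xi : phase_space R G) phi : 'I_d -> G -> C :=
  fun m => tfshift xi (phi m).
(** The coefficient function C_p phi for a single window p. *)
Definition analysis p phi : lattice_mtype L -> C :=
  fun x => rowip phi (rowshift (val x) p).

Lemma rowL2D phi psi : rowL2 phi -> rowL2 psi -> rowL2 (phi + psi).
Proof. by move=> Lp Lq m; exact: L2D. Qed.

Lemma rowL2B phi psi : rowL2 phi -> rowL2 psi -> rowL2 (phi - psi).
Proof. by move=> Lp Lq m; exact: L2B. Qed.

Lemma rowL2Z (c : C) phi : rowL2 phi -> rowL2 (fun m t => c * phi m t).
Proof. by move=> Lp m; exact: L2Z. Qed.

Lemma rowL2_shift xi phi : rowL2 phi -> rowL2 (rowshift xi phi).
Proof. by move=> Lp m; exact: tfshift_L2. Qed.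

Lemma rowipDl phi psi p : rowL2 phi -> rowL2 psi -> rowL2 p ->
  rowip (phi + psi) p = rowip phi p + rowip psi p.
Proof.
move=> Lphi Lpsi Lp; rewrite /rowip -big_split /=; apply: eq_bigr => m _.
exact: ipDl.
Qed.

Lemma rowipZl (c : C) phi p : rowL2 phi -> rowL2 p ->
  rowip (fun m t => c * phi m t) p = c * rowip phi p.
Proof.
by move=> Lphi Lp; rewrite /rowip mulr_sumr; apply: eq_bigr => m _; exact: ipZl.
Qed.

Lemma rowipC phi psi : rowL2 phi -> rowL2 psi -> rowip phi psi = (rowip psi phi)^*%C.
Proof.
move=> Lphi Lpsi; rewrite /rowip rmorph_sum; apply: eq_bigr => m _.
exact: ipC.
Qed.

Lemma rowipDr phi psi p : rowL2 phi -> rowL2 psi -> rowL2 p ->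
  rowip p (phi + psi) = rowip p phi + rowip p psi.
Proof.
move=> Lphi Lpsi Lp; rewrite rowipC ?rowipDl//; last exact: rowL2D.
by rewrite conjD -(rowipC Lp Lphi) -(rowipC Lp Lpsi).
Qed.

Lemma rowipZr (c : C) phi p : rowL2 phi -> rowL2 p ->
  rowip p (fun m t => c * phi m t) = c^*%C * rowip p phi.
Proof.
move=> Lphi Lp; rewrite rowipC ?rowipZl//; last exact: rowL2Z.
by rewrite conjM -(rowipC Lp Lphi).
Qed.

Lemma rowip_shift xi phi psi : rowL2 phi -> rowL2 psi ->
  rowip (rowshift xi phi) (rowshift xi psi) = rowip phi psi.
Proof. by move=> Lp Lq; apply: eq_bigr => m _; exact: ip_tfshift. Qed.

Lemma rowshift_onto xi psi : rowL2 psi ->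
  exists2 psi', rowL2 psi' & psi = rowshift xi psi'.
Proof.
move=> Lpsi.
have /choice[psi' H] : forall m, exists f, L2 mu f /\ psi m = tfshift xi f.
  by move=> m; have [f Lf ->] := tfshift_onto mu_haar xi (Lpsi m); exists f.
by exists psi' => [m|]; [have [] := H m|apply/funext => m; have [] := H m].
Qed.

Lemma oppr_row phi : - phi = (fun m t => -1 * phi m t).
Proof. by apply/funext => m; apply/funext => t; rewrite mulN1r. Qed.

Lemma analysisD p phi psi : rowL2 p -> rowL2 phi -> rowL2 psi ->
  analysis p (phi + psi) = (fun x => analysis p phi x + analysis p psi x).
Proof.
by move=> Lp Lphi Lpsi; apply/funext => x; apply: rowipDl => //; exact: rowL2_shift.
Qed.

Lemma analysisZ (c : C) p phi : rowL2 p -> rowL2 phi ->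
  analysis p (fun m t => c * phi m t) = (fun x => c * analysis p phi x).
Proof.
by move=> Lp Lphi; apply/funext => x; apply: rowipZl => //; exact: rowL2_shift.
Qed.

Lemma analysisB p phi psi : rowL2 p -> rowL2 phi -> rowL2 psi ->
  analysis p (phi - psi) = (fun x => analysis p phi x - analysis p psi x).
Proof.
move=> Lp Lphi Lpsi; rewrite analysisD// oppr_row ?analysisZ//; last exact: rowL2Z.
by apply/funext => x; rewrite mulN1r.
Qed.

Lemma analysisMn p phi k : rowL2 p -> rowL2 phi ->
  analysis p (phi *+ k) = (fun x => k%:R * analysis p phi x).
Proof.
move=> Lp Lphi; rewrite -analysisZ//; congr analysis.
apply/funext => m; apply/funext => t; rewrite mulr_natl.
by elim: k => // k IH; rewrite !mulrS -IH.
Qed.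

Lemma analysis_windowD p q phi : rowL2 p -> rowL2 q -> rowL2 phi ->
  analysis (p + q) phi = (fun x => analysis p phi x + analysis q phi x).
Proof.
move=> Lp Lq Lphi; apply/funext => x; rewrite -rowipDr//; try exact: rowL2_shift.
congr rowip; apply/funext => m; apply/funext => t.
by rewrite /rowshift /tfshift /= mulrDr.
Qed.

Lemma analysis_windowB p q phi : rowL2 p -> rowL2 q -> rowL2 phi ->
  analysis (p - q) phi = (fun x => analysis p phi x - analysis q phi x).
Proof.
move=> Lp Lq Lphi; rewrite analysis_windowD//; last first.
  by rewrite oppr_row; exact: rowL2Z.
apply/funext => x; congr (_ + _); rewrite oppr_row -[RHS]mulN1r -[X in _ = X * _]conjN1.
rewrite /analysis -rowipZr//; last exact: rowL2_shift.
congr rowip; apply/funext => m; apply/funext => t.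
by rewrite /rowshift /tfshift /= mulrCA.
Qed.

Definition lattice_shift (l x : lattice_mtype L) : lattice_mtype L :=
  exist _ (val l + val x) (rpredD (valP l) (valP x)).
Definition lattice_opp (x : lattice_mtype L) : lattice_mtype L :=
  exist _ (- val x) (rpredNr (valP x)).

Lemma cintegral_lattice_shift (l : lattice_mtype L) (a : lattice_mtype L -> C) :
  cintegral cnt (fun x => a (lattice_shift l x)) = cintegral cnt a.
Proof.
apply: (@cintegral_comp _ _ _ cnt (lattice_shift l)).
- exact: lattice_measurable_fun.
- move=> A _; apply: (@counting_bij _ _ _ _ (lattice_shift (lattice_opp l))).
  + by move=> x; apply/val_inj => /=; rewrite addKr.
  + by move=> x; apply/val_inj => /=; rewrite addNKr.
- exact: lattice_cmeasurable.
Qed.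

Lemma energy_lattice_opp (a : lattice_mtype L -> C) :
  energy cnt (fun x => a (lattice_opp x)) = energy cnt a.
Proof.
apply: (@energy_comp _ _ _ cnt lattice_opp).
- exact: lattice_measurable_fun.
- move=> A _; apply: (@counting_bij _ _ _ _ lattice_opp).
  + by move=> x; apply/val_inj => /=; rewrite opprK.
  + by move=> x; apply/val_inj => /=; rewrite opprK.
- exact: lattice_cmeasurable.
Qed.

(** The phase depends on the lattice points but not on phi, hence cancels in the
    inner product of two coefficient functions. *)
Lemma analysis_shift p phi (l x : lattice_mtype L) : rowL2 p -> rowL2 phi ->
  analysis p (rowshift (val l) phi) (lattice_shift l x) =
  (((val x).2 (val l).1)^*%C * analysis p phi x).
Proof.
move=> Lp Lphi; rewrite /analysis -(@rowip_shift (val l) phi)//; last first.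
  exact: rowL2_shift.
set c := (val x).2 (val l).1.
have -> : rowshift (val l) (rowshift (val x) p) =
    (fun m t => c^*%C * rowshift (val (lattice_shift l x)) p m t).
  by apply/funext => m; rewrite /rowshift tfshiftD.
rewrite rowipZr//; [|exact: rowL2_shift..].
by rewrite mulrA -conjM char_conj conjc1 mul1r.
Qed.

Lemma ip_analysis_shift p phi psi (l : lattice_mtype L) :
  rowL2 p -> rowL2 phi -> rowL2 psi ->
  ip cnt (analysis p (rowshift (val l) phi)) (analysis p (rowshift (val l) psi)) =
  ip cnt (analysis p phi) (analysis p psi).
Proof.
move=> Lp Lphi Lpsi; rewrite /ip -[LHS](cintegral_lattice_shift l).
congr cintegral; apply/funext => x; rewrite !analysis_shift//.
by rewrite conjM mulrACA -conjM char_conj conjc1 mul1r.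
Qed.

End rows.

(** * Frame relations *)

Section frames.
Variables (R : realType) (G : topologicalZmodType).
Variables (mu : {measure set (borel G) -> \bar R}).
Hypothesis mu_haar : is_haar mu.
Variable L : zmodClosed (phase_space R G).
Local Notation C := R[i].
Local Notation cnt := (@counting (lattice_mtype L) R).
Variables (d n : nat) (g : 'I_n -> 'I_d -> G -> C).
Hypothesis gL2 : forall l, rowL2 mu (g l).
Local Notation X := ('I_d -> G -> C).
Local Notation an l phi := (@analysis R G mu L d (g l) phi).
Implicit Types (phi psi chi v u f : X) (W : pred 'I_n).

(** For a set W of windows without square-summable coefficients the value is not
    meaningful in itself: each divergent inner product contributes a default
    value. *)
Definition gram (W : pred 'I_n) phi psi : C :=
  \sum_(l | W l) ip cnt (an l phi) (an l psi).

(** The weak form of S phi = v, where S is the frame operator of the windows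
    in W. *)
Definition frame_rel (W : pred 'I_n) phi v :=
  forall psi, rowL2 mu psi -> rowip mu v psi = gram W phi psi.

Definition square_summable (l : 'I_n) := forall phi, rowL2 mu phi -> L2 cnt (an l phi).

Lemma Re_gramC W phi psi :
  complex.Re (gram W phi psi) = complex.Re (gram W psi phi).
Proof.
by rewrite [LHS]Re_sum [RHS]Re_sum; apply: eq_bigr => l _; exact: Re_ipC.
Qed.

Lemma Re_gram_diag W phi :
  complex.Re (gram W phi phi) = \sum_(l | W l) fine (energy cnt (an l phi)).
Proof. by rewrite [LHS]Re_sum; apply: eq_bigr => l _; exact: Re_ip_energy. Qed.

Lemma gramDr W phi psi chi : (forall l, W l -> square_summable l) ->
  rowL2 mu phi -> rowL2 mu psi -> rowL2 mu chi ->
  gram W phi (psi + chi) = gram W phi psi + gram W phi chi.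
Proof.
move=> WS Lphi Lpsi Lchi; rewrite /gram -big_split /=.
apply: eq_bigr => l /WS Wl; rewrite analysisD//.
by apply: ipDr; exact: Wl.
Qed.

Lemma gramZr W (c : C) phi psi : (forall l, W l -> square_summable l) ->
  rowL2 mu phi -> rowL2 mu psi ->
  gram W phi (fun m t => c * psi m t) = c^*%C * gram W phi psi.
Proof.
move=> WS Lphi Lpsi; rewrite /gram mulr_sumr.
apply: eq_bigr => l /WS Wl; rewrite analysisZ//.
by apply: ipZr; exact: Wl.
Qed.

Lemma gramC W phi psi : (forall l, W l -> square_summable l) ->
  rowL2 mu phi -> rowL2 mu psi -> gram W phi psi = (gram W psi phi)^*%C.
Proof.
move=> WS Lphi Lpsi; rewrite /gram rmorph_sum.
by apply: eq_bigr => l /WS Wl; apply: ipC; exact: Wl.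
Qed.

Definition good_windows : pred 'I_n := fun l => `[< square_summable l >].

Lemma good_square_summable l : good_windows l -> square_summable l.
Proof. by move/asboolP. Qed.

(** That S is everywhere defined makes the form b additive in its second
    argument, despite the default values that may enter it. *)
Section drop_unsummable.
Hypothesis frame_rel_ex : forall phi, rowL2 mu phi ->
  exists2 v, rowL2 mu v & frame_rel xpredT phi v.

Let b phi psi := complex.Re (gram xpredT phi psi).

Let bD phi psi chi : rowL2 mu phi -> rowL2 mu psi -> rowL2 mu chi ->
  b phi (psi + chi) = b phi psi + b phi chi.
Proof.
move=> Lphi Lpsi Lchi; have [v Lv Hv] := frame_rel_ex Lphi.
rewrite /b -!Hv//; last exact: rowL2D.
by rewrite rowipDr// cReD.
Qed.

(** [unsummable_vanish] for the quadratic form of S. *)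
Lemma energy_analysis_unsummable l psi : rowL2 mu psi -> ~ square_summable l ->
  fine (energy cnt (an l psi)) = 0.
Proof.
move=> Lpsi /existsNP[phi /not_implyP[Lphi nL2]].
have L2an i x : rowL2 mu x -> (energy cnt (an i x) < +oo)%E -> L2 cnt (an i x).
  by move=> Lx ex; apply/L2E; split => //; exact: lattice_cmeasurable.
refine (@unsummable_vanish R X 'I_n (@rowL2 R G mu d)
  (fun i x => (energy cnt (an i x) < +oo)%E)
  (fun i x => fine (energy cnt (an i x))) _ _ _ _ _ _ _ _ l phi psi Lphi Lpsi _).
- exact: rowL2D.
- exact: rowL2B.
- move=> i x y Lx Ly ex ey; rewrite analysisB//.
  by have /L2E[] := L2B (L2an _ _ Lx ex) (L2an _ _ Ly ey).
- move=> i x k Lx; rewrite analysisMn//; split=> ex; last first.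
    by have /L2E[] := L2Z k.+1%:R (L2an _ _ Lx ex).
  have : L2 cnt (fun z => k.+1%:R * an i x z).
    by apply/L2E; split => //; exact: lattice_cmeasurable.
  move=> /(L2Z k.+1%:R^-1)/L2E[_].
  by under eq_fun do rewrite mulKf ?pnatr_eq0//.
- by move=> i x; rewrite fine_ge0// energy_ge0.
- move=> i x; have := energy_ge0 cnt (an i x).
  by case: (energy _ _) => [r _ []|_ _|] //; rewrite ltry.
- move=> i x y Lx Ly /(L2an _ _ Lx) ax /(L2an _ _ Ly) ay.
  rewrite (analysisD mu_haar L (gL2 i) Lx Ly) (analysisB mu_haar L (gL2 i) Lx Ly).
  exact: fine_energy_par ax ay.
- move=> x y Lx Ly.
  have E z : \sum_i fine (energy cnt (an i z)) = b z z.
    exact: esym (Re_gram_diag xpredT z).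
  have F (s1 s2 s3 s4 t1 t2 t3 t4 : R) : s1 = t1 -> s2 = t2 -> s3 = t3 ->
      s4 = t4 -> t1 + t2 = 2 * (t3 + t4) -> s1 + s2 = 2 * (s3 + s4).
    by move=> -> -> -> ->.
  apply: (F _ _ _ _ _ _ _ _ (E (x + y)) (E (x - y)) (E x) (E y)).
  exact: (symform_par (@rowL2B R G mu d) (@rowL2D R G mu d) (Re_gramC xpredT) bD Lx Ly).
- by move=> /(L2an _ _ Lphi).
Qed.

(** Both forms have the same diagonal by the previous lemma, hence the same real
    part; replacing psi by a multiple of i gives the imaginary part. *)
Lemma frame_rel_good phi v : rowL2 mu phi -> rowL2 mu v ->
  frame_rel xpredT phi v -> frame_rel good_windows phi v.
Proof.
have diag psi : rowL2 mu psi -> b psi psi = complex.Re (gram good_windows psi psi).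
  move=> Lpsi; rewrite /b !Re_gram_diag [RHS]big_mkcond/=.
  apply: eq_bigr => l _; case: ifPn => // /asboolPn nS.
  exact: energy_analysis_unsummable.
have Re_eq chi psi : rowL2 mu chi -> rowL2 mu psi ->
    b chi psi = complex.Re (gram good_windows chi psi).
  apply: (symform_ext (@rowL2D R G mu d) (Re_gramC xpredT) (Re_gramC good_windows)
    bD _ diag) => x y z Lx Ly Lz.
  exact: etrans (congr1 (@complex.Re R) (gramDr good_square_summable Lx Ly Lz))
    (cReD _ _).
move=> Lphi Lv Hv psi Lpsi.
have Re_v chi : rowL2 mu chi ->
    complex.Re (rowip mu v chi) = complex.Re (gram good_windows phi chi).
  by move=> Lchi; rewrite Hv//; exact: Re_eq.
apply/eqP; rewrite eq_complex Re_v// eqxx /=; apply/eqP.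
have := Re_v _ (rowL2Z 'i%C Lpsi).
rewrite rowipZr// gramZr//; last exact: good_square_summable.
by rewrite !cReM /= !mul0r !sub0r !mulN1r !opprK.
Qed.

End drop_unsummable.
End frames.

(** * Canonical dual windows *)

Section dual_windows.
Variables (R : realType) (G : topologicalZmodType).
Variables (mu : {measure set (borel G) -> \bar R}).
Hypothesis mu_haar : is_haar mu.
Variable L : zmodClosed (phase_space R G).
Local Notation C := R[i].
Local Notation cnt := (@counting (lattice_mtype L) R).
Variables (d n : nat) (g : 'I_n -> 'I_d -> G -> C).
Hypothesis gL2 : forall l, rowL2 mu (g l).
Local Notation X := ('I_d -> G -> C).
Local Notation an p phi := (@analysis R G mu L d p phi).
Implicit Types (phi psi chi v u f : X).
Variable W : pred 'I_n.
Hypothesis WS : forall l, W l -> @square_summable R G mu L d n g l.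
Local Notation frel := (@frame_rel R G mu L d n g W).

(** The lattice shift permutes the coefficients up to unimodular phases, which
    cancel, and counting measure is invariant under the permutation. *)
Lemma frame_rel_shift (l : lattice_mtype L) phi v :
  rowL2 mu phi -> rowL2 mu v -> frel phi v ->
  frel (rowshift (val l) phi) (rowshift (val l) v).
Proof.
move=> Lphi Lv H psi Lpsi.
have [psi' Lpsi' ->] := rowshift_onto mu_haar (val l) Lpsi.
apply: (etrans (rowip_shift mu_haar (val l) Lv Lpsi')).
apply: (etrans (H _ Lpsi')); apply: eq_bigr => i _.
exact: esym (ip_analysis_shift mu_haar l (gL2 i) Lphi Lpsi').
Qed.

Variable gam : 'I_n -> X.
Hypothesis gamL2 : forall l, rowL2 mu (gam l).
Hypothesis gamP : forall l, W l -> frel (gam l) (g l).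

(** The inner product z of a window with its dual satisfies Re z >= |z|^2, keeping
    only the term of window l at the lattice point 0. *)
Lemma Re_dual_window_le1 l : W l -> complex.Re (rowip mu (g l) (gam l)) <= 1.
Proof.
move=> Wl; set z := rowip mu (g l) (gam l).
have zE : complex.Re z = \sum_(i | W i) fine (energy cnt (an (g i) (gam l))).
  by rewrite /z (gamP Wl (gamL2 l)); exact: Re_gram_diag.
have : sqn z <= complex.Re z.
  rewrite zE (bigD1 l)//=; apply: ler_wpDr.
    by apply: sumr_ge0 => i _; rewrite fine_ge0// energy_ge0.
  have aL2 := WS Wl (gamL2 l).
  have := @energy_point R _ L (an (g l) (gam l)) (exist _ 0 (rpred0 L)).
  rewrite -(energy_fin aL2) lee_fin; apply: le_trans.
  rewrite /analysis /z (rowipC (gL2 l) (gamL2 l)) sqnJ.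
  rewrite (_ : rowshift _ (g l) = g l)//.
  by apply/funext => m; exact: tfshift0.
rewrite /sqn; have := sqr_ge0 (complex.Im z).
move: (complex.Re z) => r; move: (complex.Im z ^+ 2) => s; nra.
Qed.

(** S is self-adjoint and commutes with lattice shifts, so
    <f, pi(x) gamma_l> = <S u, pi(x) gamma_l> = <u, pi(x) g_l>. In particular
    the coefficients of f for gamma_l are square-summable. *)
Lemma analysis_dual l u f : W l -> rowL2 mu u -> rowL2 mu f -> frel u f ->
  an (gam l) f = an (g l) u.
Proof.
move=> Wl Lu Lf uf; apply/funext => x; rewrite /analysis.
have Lsg : rowL2 mu (rowshift (val x) (g l)) by exact: rowL2_shift.
have Lsgam : rowL2 mu (rowshift (val x) (gam l)) by exact: rowL2_shift.
rewrite (uf _ Lsgam) (gramC WS Lu Lsgam) (rowipC Lu Lsg).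
by rewrite (frame_rel_shift x (gamL2 l) (gL2 l) (gamP Wl) Lu).
Qed.

(** The real part of the reconstruction formula
    |f|^2 = sum_l <C_(g_l) f, C_(gam_l) f>, rid of its signed terms. *)
Lemma frame_polarization u f : rowL2 mu u -> rowL2 mu f -> frel u f ->
  (\sum_(l | W l) energy cnt (an (g l + gam l)%R f) =
   \sum_(l | W l) energy cnt (an (g l - gam l)%R f) +
   (4 * complex.Re (rowip mu f f))%:E)%E.
Proof.
move=> Lu Lf uf.
have -> : complex.Re (rowip mu f f) =
    \sum_(l | W l) complex.Re (ip cnt (an (g l) f) (an (gam l) f)).
  rewrite (uf _ Lf) (gramC WS Lu Lf) cReJ Re_sum.
  by apply: eq_bigr => l Wl; rewrite (analysis_dual Wl Lu Lf uf).
rewrite mulr_sumr -sumEFin -big_split /=; apply: eq_bigr => l Wl.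
rewrite (analysis_windowD mu_haar L (gL2 l) (gamL2 l) Lf).
rewrite (analysis_windowB mu_haar L (gL2 l) (gamL2 l) Lf).
apply: energy_polarization; first exact: WS.
by rewrite (analysis_dual Wl Lu Lf uf); exact: WS.
Qed.

End dual_windows.

(** * From matrix frames to frames of rows *)

Section matrix_rows.
Variables (R : realType) (G : topologicalZmodType).
Variables (mu : {sigma_finite_measure set (borel G) -> \bar R}).
Variable L : zmodClosed (phase_space R G).
Local Notation C := R[i].
Variables (n d : nat) (g : 'M[G -> C]_(n, d)).
Variable k0 : 'I_n.

Definition mxrow_at (phi : 'I_d -> G -> C) : 'M[G -> C]_(n, d) :=
  \matrix_(k, m) if k == k0 then phi m else (fun _ => 0).

Lemma mxrow_at_L2 phi : rowL2 mu phi -> L2mx mu (mxrow_at phi).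
Proof. by move=> Lphi k m; rewrite mxE; case: ifP => _ //; exact: L20. Qed.

(** Rows do not interact: testing against matrices supported on the row k0
    isolates the row k0 of f and v. *)
Lemma frame_operator_row (f v : 'M[G -> C]_(n, d)) : frame_operator mu L g f v ->
  @frame_rel R G mu L d n (fun l m => g l m) xpredT (fun m => f k0 m) (fun m => v k0 m).
Proof.
move=> [_ H] psi Lpsi; have := H _ (mxrow_at_L2 Lpsi).
have -> : ipmx mu v (mxrow_at psi) = rowip mu (fun m => v k0 m) psi.
  rewrite /ipmx (bigD1 k0)//= [X in _ + X]big1 ?addr0 => [|k kk0].
    by apply: eq_bigr => m _; rewrite mxE eqxx.
  by apply: big1 => m _; rewrite mxE (negbTE kk0) ip0r.
move=> ->; rewrite /ipmx (bigD1 k0)//= [X in _ + X]big1 ?addr0 => [|k kk0].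
  apply: eq_bigr => l _; congr (ip _ _ _); apply/funext => x; rewrite mxE.
    by [].
  by apply: eq_bigr => m _; rewrite mxE eqxx.
apply: big1 => l _.
rewrite (_ : (coefficient mu L g (mxrow_at psi)) k l = (fun _ => 0)) ?ip0r//.
apply/funext => x; rewrite mxE; apply: big1 => m _.
by rewrite mxE (negbTE kk0) ip0l.
Qed.

Lemma mxrow_atE phi : (fun m => mxrow_at phi k0 m) = phi.
Proof. by apply/funext => m; rewrite mxE eqxx. Qed.

Hypothesis frame : matrix_gabor_frame mu L g.

Lemma frame_rel_total phi : rowL2 mu phi -> exists2 v, rowL2 mu v &
  @frame_rel R G mu L d n (fun l m => g l m) xpredT phi v.
Proof.
move=> Lphi; have [/(_ _ (mxrow_at_L2 Lphi))[v Lv fv] _ _ _] := frame.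
exists (fun m => v k0 m); first by move=> m; exact: Lv.
by have := frame_operator_row fv; rewrite mxrow_atE.
Qed.

Lemma frame_rel_onto v : rowL2 mu v -> exists2 phi, rowL2 mu phi &
  @frame_rel R G mu L d n (fun l m => g l m) xpredT phi v.
Proof.
move=> Lv; have [_ /(_ _ (mxrow_at_L2 Lv))[f Lf fv] _ _] := frame.
exists (fun m => f k0 m); first by move=> m; exact: Lf.
by have := frame_operator_row fv; rewrite mxrow_atE.
Qed.

End matrix_rows.

(** * Integration over the quotient by the lattice *)

Section density.
Variables (R : realType) (G : topologicalZmodType).
Hypothesis G_second_countable : @second_countable G.
Variables (mu : {sigma_finite_measure set (borel G) -> \bar R}).
Variables (nu : {sigma_finite_measure set (borel (dual R G)) -> \bar R}).
Hypotheses (mu_haar : is_haar mu) (mu_nu_plancherel : plancherel mu nu).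
Variable L : zmodClosed (phase_space R G).
Local Notation C := R[i].
Local Notation cnt := (@counting (lattice_mtype L) R).
Variable rho : {measure set (borel (lattice_quot L)) -> \bar R}.
Hypotheses (rho_fin : (rho setT < +oo)%E) (rho_weil : weil mu nu rho).
Variable d : nat.
Implicit Types (p q : 'I_d -> G -> C) (h : G -> C).

Definition column (m : 'I_d) h : 'I_d -> G -> C :=
  fun i => if i == m then h else (fun _ => 0).

Lemma column_L2 m h : L2 mu h -> rowL2 mu (column m h).
Proof. by move=> Lh i; rewrite /column; case: ifP => _ //; exact: L20. Qed.

Lemma rowip_column m h p : rowip mu (column m h) p = ip mu h (p m).
Proof.
rewrite /rowip (bigD1 m)//= /column eqxx big1 ?addr0// => i im.
by rewrite (negbTE im) ip0l.
Qed.

Lemma sqn_ip_shift h f (xi eta : phase_space R G) : L2 mu h -> L2 mu f ->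
  sqn (ip mu (tfshift xi h) (tfshift (- eta) f)) =
  sqn (stft mu h f (xi + eta)).
Proof.
move=> Lh Lf; have Lxh := tfshift_L2 mu_haar xi Lh.
have Lef := tfshift_L2 mu_haar (- eta) Lf.
rewrite (ipC Lxh Lef) sqnJ -(ip_tfshift mu_haar eta Lef Lxh) !tfshiftD subrr tfshift0.
have Lsh := tfshift_L2 mu_haar (eta + xi) Lh.
rewrite (ipZl _ Lf (L2Z _ Lsh)) (ipZr _ Lsh Lf) !sqnM !sqnJ !char_sqn !mul1r.
by rewrite /stft addrC.
Qed.

(** The reflection of the lattice turns the sum over pi(- l) p into the sum over
    the coset of xi that Weil's formula asks for. *)
Lemma energy_analysis_column m h p (xi : phase_space R G) :
  L2 mu h -> rowL2 mu p ->
  (energy cnt (@analysis R G mu L d p (column m (tfshift xi h))) =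
   \int[cnt]_l (sqn (stft mu h (p m) (xi + val l)))%:E)%E.
Proof.
move=> Lh Lp; rewrite -energy_lattice_opp; apply: eq_integral => l _.
by congr EFin; rewrite /analysis rowip_column; exact: sqn_ip_shift.
Qed.

Variable K : set G.
Hypotheses (K_open : open K) (K_sym : forall x, K (- x) <-> K x).
Hypotheses (K_gt0 : (0 < mu K)%E) (K_fin : (mu K < +oo)%E).
Local Notation h := (window R K).

Let Lh : L2 mu h. Proof. exact: window_L2. Qed.

Variables (I : finType) (W : pred I).

(** Weil's formula unfolds the integral over the quotient of the coefficients of
    the shifted window into an integral over the whole phase space, which
    [moyal] evaluates. *)
Lemma weil_moyal (p : I -> 'I_d -> G -> C) (m : 'I_d) :
  (forall l, rowL2 mu (p l)) ->
  (\int[rho]_q \sum_(l | W l) energy cnt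
     (@analysis R G mu L d (p l) (column m (tfshift (repr (q : lattice_quot L)) h))) =
   (\sum_(l | W l) energy mu (p l m)) * mu K)%E.
Proof.
move=> Lp; under eq_integral do rewrite -big_filter.
rewrite -big_filter; set s := [seq l <- index_enum I | W l].
pose S l (xi : borel G * borel (dual R G)) : \bar R :=
  (sqn (stft mu h (p l m) xi))%:E.
have mS l : measurable_fun setT (S l).
  by apply: measurable_sqn; apply: stft_measurable => //; exact: Lp.
have S0 l xi : (0 <= S l xi)%E by rewrite lee_fin sqn_ge0.
transitivity (\int[(mu \x nu)%E]_xi \sum_(l <- s) S l xi)%E.
  rewrite rho_weil; last 2 first.
  - exact: emeasurable_sum.
  - by move=> xi; apply: sume_ge0.
  apply: eq_integral => q _; rewrite ge0_integral_sum//.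
  - by apply: eq_bigr => l _; apply: energy_analysis_column => //; exact: Lp.
  - by move=> l; exact: lattice_measurable_fun.
rewrite ge0_integral_sum// ge0_sume_distrl; last first.
  by move=> l _; exact: energy_ge0.
by apply: eq_bigr => l _; apply: moyal => //; exact: Lp.
Qed.

Variables g gam : I -> 'I_d -> G -> C.
Hypotheses (gL2 : forall l, rowL2 mu (g l)) (gamL2 : forall l, rowL2 mu (gam l)).
Hypothesis polar : forall f, rowL2 mu f ->
  (\sum_(l | W l) energy cnt (@analysis R G mu L d (g l + gam l)%R f) =
   \sum_(l | W l) energy cnt (@analysis R G mu L d (g l - gam l)%R f) +
   (4 * complex.Re (rowip mu f f))%:E)%E.

(** Integrate the polarized reconstruction formula over the quotient. The
    constant term contributes 4 mu(K) times the size of the lattice, and the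
    difference of the two other terms is 4 mu(K) times the sum of the inner
    products. *)
Lemma density_column (m : 'I_d) :
  (rho setT <= (\sum_(l | W l) complex.Re (ip mu (g l m) (gam l m)))%:E)%E.
Proof.
pose k := fine (mu K); have kE : (k%:E = mu K)%E by rewrite fineK// ge0_fin_numE.
have k0 : 0 < k by rewrite -lte_fin kE.
pose P (x : borel (lattice_quot L)) : \bar R := (\sum_(l | W l) energy cnt
  (@analysis R G mu L d (g l + gam l)%R
    (column m (tfshift (repr (x : lattice_quot L)) h))))%E.
pose N (x : borel (lattice_quot L)) : \bar R := (\sum_(l | W l) energy cnt
  (@analysis R G mu L d (g l - gam l)%R
    (column m (tfshift (repr (x : lattice_quot L)) h))))%E.
have EP : (\int[rho]_x P x =
    (\sum_(l | W l) energy mu ((g l + gam l)%R m)) * mu K)%E.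
  exact: weil_moyal m (fun l => rowL2D (gL2 l) (gamL2 l)).
have EN : (\int[rho]_x N x =
    (\sum_(l | W l) energy mu ((g l - gam l)%R m)) * mu K)%E.
  exact: weil_moyal m (fun l => rowL2B (gL2 l) (gamL2 l)).
have PN x : (P x = N x + (4 * k)%:E)%E.
  have Lth := tfshift_L2 mu_haar (repr (x : lattice_quot L)) Lh.
  apply: (etrans (polar (column_L2 m Lth))); congr (_ + (4 * _)%:E)%E.
  rewrite rowip_column /column eqxx (ip_tfshift mu_haar _ Lh Lh) Re_ip_energy.
  by rewrite window_energy.
have N0 x : (0 <= N x)%E by apply: sume_ge0 => l _; exact: energy_ge0.
clearbody P N.
have Re0 : 0 <= 4 * k by rewrite mulr_ge0// ltW.
have := integral_addr_ge N0 Re0 rho_fin.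
have <- : (\int[rho]_x P x = \int[rho]_x (N x + (4 * k)%:E))%E.
  by apply: eq_integral => x _; exact: PN.
rewrite EP EN.
have -> : (\sum_(l | W l) energy mu ((g l + gam l)%R m) =
    \sum_(l | W l) energy mu ((g l - gam l)%R m) +
    (4 * \sum_(l | W l) complex.Re (ip mu (g l m) (gam l m)))%:E)%E.
  rewrite mulr_sumr -sumEFin -big_split /=; apply: eq_bigr => l _.
  exact: energy_polarization (gL2 l m) (gamL2 l m).
have -> : (\sum_(l | W l) energy mu ((g l - gam l)%R m) =
    (\sum_(l | W l) fine (energy mu ((g l - gam l)%R m)))%:E)%E.
  rewrite -sumEFin; apply: eq_bigr => l _.
  exact: esym (energy_fin (L2B (gL2 l m) (gamL2 l m))).
move: (\sum_(l | W l) fine _) (\sum_(l | W l) complex.Re _) => s t.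
rewrite -kE -(@fineK _ (rho setT)) ?ge0_fin_numE//.
move: (fine (rho setT)) => r.
move=> H; have {H} : ((s * k + 4 * k * r)%:E <= ((s + 4 * t) * k)%:E)%E := H.
rewrite lee_fin (mulrDl s (4 * t) k) lerD2l (mulrAC 4 t).
by rewrite ler_pM2l// mulr_gt0.
Qed.

End density.

Theorem proposition4p35 (R : realType) (G : topologicalZmodType)
  (G_hausdorff : hausdorff_space G)
  (G_locally_compact : locally_compact [set: G])
  (G_second_countable : @second_countable G)
  (mu : {sigma_finite_measure set (borel G) -> \bar R})
  (nu : {sigma_finite_measure set (borel (dual R G)) -> \bar R})
  (mu_haar : is_haar mu) (nu_haar : is_haar nu)
  (mu_nu_plancherel : plancherel mu nu)
  (L : zmodClosed (phase_space R G)) (L_lattice : is_lattice L)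
  (rho : {measure set (borel (lattice_quot L)) -> \bar R})
  (rho_haar : is_haar rho) (rho_weil : weil mu nu rho)
  (n d : nat) (n_gt0 : (0 < n)%N) (d_gt0 : (0 < d)%N) :
  (exists g : 'M[G -> R[i]]_(n, d),
     (forall i j, heisenberg_module mu nu L (g i j)) /\
     matrix_gabor_frame mu L g) ->
  (lattice_size rho <= (n%:R / d%:R)%:E)%E.
Proof.
move=> [g0 [gE frame]].
pose g l m := g0 l m.
have gL2 l : rowL2 mu (g l) by move=> m; have [] := gE l m.
have k0 := Ordinal n_gt0.
have rho_fin : (rho setT < +oo)%E.
  by have [_ fin _] := rho_haar; apply: fin; have [_] := L_lattice.
pose W := @good_windows R G mu L d n g.
have WS : forall l, W l -> @square_summable R G mu L d n g l.
  exact: good_square_summable.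
have onto v : rowL2 mu v ->
    exists2 phi, rowL2 mu phi & @frame_rel R G mu L d n g W phi v.
  move=> Lv; have [phi Lphi H] := frame_rel_onto k0 frame Lv.
  exists phi => //.
  exact: (frame_rel_good mu_haar gL2 (frame_rel_total k0 frame) Lphi Lv H).
have /choice[gam gamP] : forall l, exists phi,
    rowL2 mu phi /\ @frame_rel R G mu L d n g W phi (g l).
  by move=> l; have [phi Lphi H] := onto _ (gL2 l); exists phi.
have gamL2 l : rowL2 mu (gam l) := (gamP l).1.
have [K [oK symK K0 Kfin]] := haar_window G_locally_compact mu_haar.
pose cnt : set (lattice_mtype L) -> \bar R := counting.
have polar f : rowL2 mu f ->
  (\sum_(l | W l) energy cnt (@analysis R G mu L d (g l + gam l)%R f) =
   \sum_(l | W l) energy cnt (@analysis R G mu L d (g l - gam l)%R f) +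
   (4 * complex.Re (rowip mu f f))%:E)%E.
  move=> Lf; have [u Lu uf] := onto _ Lf.
  exact: (frame_polarization mu_haar gL2 WS gamL2 (fun l _ => (gamP l).2) Lu Lf uf).
have size_le m : (rho setT <=
    (\sum_(l | W l) complex.Re (ip mu (g l m) (gam l m)))%:E)%E.
  exact: (density_column G_second_countable mu_haar mu_nu_plancherel rho_fin
    rho_weil oK symK K0 Kfin gL2 gamL2 polar).
rewrite /lattice_size integral_cst// mul1e.
rewrite -(@fineK _ (rho setT)) ?ge0_fin_numE//.
have {}size_le m : fine (rho setT) <=
    \sum_(l | W l) complex.Re (ip mu (g l m) (gam l m)).
  by rewrite -lee_fin fineK ?ge0_fin_numE.
rewrite lee_fin ler_pdivlMr ?ltr0n// mulr_natr.
have -> : fine (rho setT) *+ d = \sum_(m < d) fine (rho setT).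
  by rewrite sumr_const card_ord.
apply: (le_trans (ler_sum _ (fun m _ => size_le m))).
rewrite exchange_big /=.
apply: (@le_trans _ _ (\sum_(l | W l) (1 : R))).
  apply: ler_sum => l Wl.
  have := Re_dual_window_le1 gL2 WS gamL2 (fun l _ => (gamP l).2) Wl.
  by apply: le_trans; rewrite le_eqVlt [X in _ == X]Re_sum eqxx.
rewrite big_mkcond /=.
apply: (@le_trans _ _ (\sum_(l < n) (1 : R))).
  by apply: ler_sum => l _; case: ifP.
by rewrite sumr_const card_ord.
Qed.
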